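(* Let $R$ be a commutative ring with identity, let $M$ be an $R$-module, and let $\mathbf{x}$ be a finite sequence of elements of $R$. Then the following conditions are equivalent: (1) $\mathbf{x}$ is $M$-weakly proregular. (2) $H^i_{\mathbf{x}}(\operatorname{Hom}_R(M,E))=0$ for all injective $R$-modules $E$ and all $i\neq0$.
   Context: Write $\mathbf{x}=x_1,\ldots,x_\ell$ and $\mathbf{x}^m=x_1^m,\ldots,x_\ell^m$. Weakly proregular sequences: let $\mathbb{K}_\bullet(x,M)$ be the Koszul complex $0\to M\xrightarrow{x}M\to 0$ (degrees $1,0$), and $\mathbb{K}_\bullet(\mathbf{x},M)=\mathbb{K}_\bullet(x_1,R)\otimes_R\cdots\otimes_R\mathbb{K}_\bullet(x_\ell,R)\otimes_R M$ with homology $H_i(\mathbf{x},M)$. For $m\ge n$ let $\phi^m_n(\mathbf{x},M):\mathbb{K}_\bullet(\mathbf{x}^m,M)\to\mathbb{K}_\bullet(\mathbf{x}^n,M)$ be the chain map obtained by tensoring the maps $\mathbb{K}_\bullet(x_j^m,R)\to\mathbb{K}_\bullet(x_j^n,R)$ that are multiplication by $x_j^{m-n}$ in degree $1$ and the identity in degree $0$. The sequence $\mathbf{x}$ is $M$-weakly proregular if for each $n$ there is $m\ge n$ such that the induced map $H_i(\mathbf{x}^m,M)\to H_i(\mathbf{x}^n,M)$ is zero for all $i\ge1$. Čech cohomology: $C(x)$ is the complex $0\to R\to R_x\to0$ (degrees $0,1$, natural localization map), $C(\mathbf{x})=C(x_1)\otimes_R\cdots\otimes_R C(x_\ell)$,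 and for an $R$-module $N$, $H^i_{\mathbf{x}}(N)$ is the $i$th cohomology of $C(\mathbf{x})\otimes_R N$. *)

(* Defs.v *)
From HB Require Import structures.
From mathcomp Require Import all_boot all_algebra.
From mathcomp Require Import boolp functions.
From mathcomp Require Import ring.

Set Implicit Arguments.
Unset Strict Implicit.
Unset Printing Implicit Defensive.

Import GRing.Theory.
Local Open Scope ring_scope.
Local Open Scope quotient_scope.

Section Submodule.
Variables (R : pzRingType) (V : lmodType R).

Record submodule := Submodule {
  smem :> V -> Prop;
  smem0 : smem 0;
  smemP : forall a x y, smem x -> smem y -> smem (a *: x + y)
}.

Variable W : submodule.

Definition smemb : {pred V} := fun x => `[< W x >].

Lemma smemb_closed : submod_closed smemb.
Proof.
split=> [|a x y /asboolP Wx /asboolP Wy]; apply/asboolP; first exact: smem0.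
exact: smemP.
Qed.
HB.instance Definition _ := GRing.isSubmodClosed.Build R V smemb smemb_closed.

Record submod := Submod { submod_val :> V; submod_valP : submod_val \in smemb }.

HB.instance Definition _ := [isSub for submod_val].
HB.instance Definition _ := [Choice of submod by <:].
HB.instance Definition _ := [SubChoice_isSubLmodule of submod by <:].

Lemma submod_val_linear : linear submod_val.
Proof. by move=> a x y; exact: (linearP (val : submod -> V)). Qed.
HB.instance Definition _ :=
  GRing.isLinear.Build R submod V *:%R submod_val submod_val_linear.

End Submodule.

Section QuotientModule.
Variables (R : pzRingType) (V : lmodType R) (W : submodule V).

Definition quotmod : Type := Quotient.quot (smemb W).
HB.instance Definition _ := GRing.Zmodule.on quotmod.

Definition qpi (x : V) : quotmod := \pi_(Quotient.quot (smemb W)) x.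

Lemma qpiD x y : qpi (x + y) = qpi x + qpi y.
Proof. exact: raddfD. Qed.

Lemma qpi_surj (q : quotmod) : exists x, q = qpi x.
Proof. by exists (repr q); rewrite /qpi reprK. Qed.

Lemma qpi_eq x y : (qpi x = qpi y) <-> W (x - y).
Proof.
have e : `[< W (x - y) >] = (qpi x == qpi y).
  exact: (Quotient.idealrBE (smemb W) x y).
split=> [/eqP|Wxy]; first by rewrite -e => /asboolP.
by apply/eqP; rewrite -e; apply/asboolP.
Qed.

Definition qscale (a : R) (q : quotmod) : quotmod := qpi (a *: (repr q : V)).

Lemma qscale_pi a x : qscale a (qpi x) = qpi (a *: x).
Proof.
apply/qpi_eq; rewrite -scalerBr -[_ *: _]addr0; apply: smemP; last exact: smem0.
by apply/qpi_eq; rewrite /qpi reprK.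
Qed.

Lemma qscaleA a b q : qscale a (qscale b q) = qscale (a * b) q.
Proof. by have [x ->] := qpi_surj q; rewrite !qscale_pi scalerA. Qed.

Lemma qscale1 : left_id 1 qscale.
Proof. by move=> q; have [x ->] := qpi_surj q; rewrite qscale_pi scale1r. Qed.

Lemma qscaleDr : right_distributive qscale +%R.
Proof.
move=> a p q; have [x ->] := qpi_surj p; have [y ->] := qpi_surj q.
by rewrite -qpiD !qscale_pi scalerDr qpiD.
Qed.

Lemma qscaleDl q : {morph qscale^~ q : a b / a + b}.
Proof.
move=> a b; have [x ->] := qpi_surj q.
by rewrite !qscale_pi scalerDl qpiD.
Qed.

HB.instance Definition _ := GRing.Zmodule_isLmodule.Build R quotmod
  qscaleA qscale1 qscaleDr qscaleDl.

Lemma qpi_linear : linear qpi.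
Proof. by move=> a x y; rewrite qpiD -qscale_pi. Qed.
HB.instance Definition _ := GRing.isLinear.Build R V quotmod *:%R qpi qpi_linear.

Section Lift.
Variables (U : lmodType R) (f : {linear V -> U}).
Hypothesis fW : forall x, W x -> f x = 0.

Definition qlift_fun (q : quotmod) : U := f (repr q).

Lemma qlift_fun_pi x : qlift_fun (qpi x) = f x.
Proof.
apply/eqP; rewrite -subr_eq0 -linearB; apply/eqP/fW.
by apply/qpi_eq; rewrite /qpi reprK.
Qed.

Lemma qlift_linear : linear qlift_fun.
Proof.
move=> a p q; have [x ->] := qpi_surj p; have [y ->] := qpi_surj q.
by rewrite -linearP !qlift_fun_pi linearP.
Qed.
HB.instance Definition _ :=
  GRing.isLinear.Build R quotmod U *:%R qlift_fun qlift_linear.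

Definition qlift : {linear quotmod -> U} := qlift_fun.

Lemma qlift_pi x : qlift (qpi x) = f x.
Proof. exact: qlift_fun_pi. Qed.

End Lift.
End QuotientModule.

Section FreeModule.
Variables (R : pzRingType) (T : eqType).

Definition finsupp (f : T -> R^o) :=
  exists s : seq T, forall t, t \notin s -> f t = 0.

Lemma finsupp0 : finsupp 0.
Proof. by exists [::]. Qed.

Lemma finsuppP a f g : finsupp f -> finsupp g -> finsupp (a *: f + g).
Proof.
move=> [s sP] [s' sP']; exists (s ++ s').
move=> t; rewrite mem_cat negb_or => /andP[ts ts'].
by change (a *: f t + g t = 0); rewrite sP // sP' // scaler0 addr0.
Qed.

Definition freemod := submod (Submodule finsupp0 finsuppP).
HB.instance Definition _ := GRing.Lmodule.on freemod.

Lemma fbasis_subproof t : (fun u => (u == t)%:R : R^o) \in smemb (Submodule finsupp0 finsuppP).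
Proof.
by apply/asboolP; exists [:: t] => u; rewrite inE => /negPf ->.
Qed.
Definition fbasis t : freemod := Submod (fbasis_subproof t).

Definition fcoef (f : freemod) (t : T) : R := submod_val f t.

Definition fsupp (f : freemod) : seq T :=
  undup (sval (cid (asboolW (submod_valP f)))).

Lemma fcoefP a f g t : fcoef (a *: f + g) t = a * fcoef f t + fcoef g t.
Proof. by rewrite /fcoef linearP. Qed.

Variables (V : lmodType R) (h : T -> V).

Definition flift (f : freemod) : V :=
  \sum_(t <- fsupp f) fcoef f t *: h t.

Lemma flift_widen (f : freemod) (s : seq T) :
  uniq s -> (forall t, t \notin s -> fcoef f t = 0) ->
  flift f = \sum_(t <- s) fcoef f t *: h t.
Proof.
move=> us sP; rewrite /flift.
have uf : uniq (fsupp f) by apply: undup_uniq.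
have fP t : t \notin fsupp f -> fcoef f t = 0.
  by rewrite /fsupp; case: cid => s' s'P /=; rewrite mem_undup => /s'P.
rewrite (bigID (mem s)) /= [X in _ + X]big1 ?addr0; last first.
  by move=> t /sP ->; rewrite scale0r.
rewrite [RHS](bigID (mem (fsupp f))) /= [X in _ = _ + X]big1 ?addr0; last first.
  by move=> t /fP ->; rewrite scale0r.
rewrite -big_filter -[RHS]big_filter; apply: perm_big; apply: uniq_perm; rewrite ?filter_uniq //.
by move=> t; rewrite !mem_filter andbC.
Qed.

Lemma flift_basis t : flift (fbasis t) = h t.
Proof.
rewrite (@flift_widen _ [:: t]) // ?big_seq1 /= ?eqxx ?scale1r //.
by move=> u; rewrite inE => /negPf ->.
Qed.

Lemma flift_linear : linear flift.
Proof.
move=> a f g.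
pose s := undup (fsupp f ++ fsupp g ++ fsupp (a *: f + g)).
have fP (k : freemod) t : t \notin fsupp k -> fcoef k t = 0.
  by rewrite /fsupp; case: cid => s' s'P /=; rewrite mem_undup => /s'P.
have us : uniq s by apply: undup_uniq.
rewrite !(@flift_widen _ s) //; last 3 first.
- by move=> t; rewrite mem_undup !mem_cat !negb_or => /and3P[_ /fP].
- by move=> t; rewrite mem_undup !mem_cat !negb_or => /and3P[/fP].
- by move=> t; rewrite mem_undup !mem_cat !negb_or => /and3P[_ _ /fP].
rewrite scaler_sumr -big_split /=; apply: eq_bigr => t _.
by rewrite scalerA -scalerDl -fcoefP.
Qed.
HB.instance Definition _ :=
  GRing.isLinear.Build R freemod V *:%R flift flift_linear.

Lemma fcoef_basis t u : fcoef (fbasis t) u = (u == t)%:R.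
Proof. by []. Qed.

End FreeModule.

Lemma freemod_decomp (R : pzRingType) (T : eqType) (w : freemod R T) :
  w = flift (@fbasis R T) w.
Proof.
have fP t : t \notin fsupp w -> fcoef w t = 0.
  by rewrite /fsupp; case: cid => s' s'P /=; rewrite mem_undup => /s'P.
apply: val_inj; apply/funext => t; rewrite -[LHS]/(fcoef w t) -[RHS]/(fcoef _ t).
have cS (r : seq T) : fcoef (\sum_(u <- r) fcoef w u *: fbasis R u) t =
    \sum_(u <- r) fcoef w u * (t == u)%:R.
  elim: r => [|u r IH]; first by rewrite !big_nil /fcoef raddf0.
  by rewrite !big_cons fcoefP IH fcoef_basis.
rewrite cS; have [tw|tw] := boolP (t \in fsupp w).
  rewrite (bigD1_seq t) ?undup_uniq //= eqxx mulr1 big1 ?addr0 // => u ut.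
  by rewrite eq_sym (negPf ut) mulr0.
rewrite fP // big_seq big1 // => u uw; case: eqP => [tu|]; last by rewrite mulr0.
by move: tw; rewrite tu uw.
Qed.

Lemma freemod_ext (R : pzRingType) (T : eqType) (V : lmodType R)
    (f g : {linear freemod R T -> V}) :
  (forall t, f (fbasis R t) = g (fbasis R t)) -> f =1 g.
Proof.
move=> fg w; rewrite [w]freemod_decomp /flift !linear_sum.
by apply: eq_bigr => t _; rewrite !linearZ /= fg.
Qed.

Section Span.
Variables (R : pzRingType) (V : lmodType R) (S : V -> Prop).

Inductive spanned : V -> Prop :=
| spanned0 : spanned 0
| spannedD a s v : S s -> spanned v -> spanned (a *: s + v).

Lemma spannedP a x y : spanned x -> spanned y -> spanned (a *: x + y).
Proof.
move=> Sx Sy; elim: Sx => [|b s v Ss _ IH]; first by rewrite scaler0 add0r.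
by rewrite scalerDr scalerA -addrA; apply: spannedD.
Qed.

Definition span := Submodule spanned0 spannedP.

End Span.

(* M (x) N is the free R-module on M * N modulo the bilinearity relations. *)
Section Tensor.
Variables (R : comPzRingType) (M N : lmodType R).

Inductive tensor_rel : freemod R (M * N)%type -> Prop :=
| TensorDl m m' n :
    tensor_rel (fbasis R (m + m', n) - fbasis R (m, n) - fbasis R (m', n))
| TensorDr m n n' :
    tensor_rel (fbasis R (m, n + n') - fbasis R (m, n) - fbasis R (m, n'))
| TensorZl a m n : tensor_rel (fbasis R (a *: m, n) - a *: fbasis R (m, n))
| TensorZr a m n : tensor_rel (fbasis R (m, a *: n) - a *: fbasis R (m, n)).

Definition tensor : Type := quotmod (span tensor_rel).
HB.instance Definition _ := GRing.Lmodule.on tensor.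

Definition tens (m : M) (n : N) : tensor := qpi _ (fbasis R (m, n)).

Lemma tensor_rel0 w : tensor_rel w -> qpi (span tensor_rel) w = 0.
Proof.
move=> Rw; rewrite -[RHS](raddf0 (qpi (span tensor_rel))); apply/qpi_eq.
by rewrite subr0 -[w]scale1r -[_ *: _]addr0; apply: spannedD => //; constructor.
Qed.

Lemma tens_linearl n : linear (tens^~ n).
Proof.
move=> a m m'; apply/eqP; rewrite -subr_eq0; apply/eqP.
have /tensor_rel0 := TensorDl (a *: m) m' n.
have /tensor_rel0 := TensorZl a m n.
rewrite !linearB /= linearZ /= => /eqP; rewrite subr_eq0 => /eqP <-.
by rewrite opprD addrA.
Qed.

Lemma tens_linearr m : linear (tens m).
Proof.
move=> a n n'; apply/eqP; rewrite -subr_eq0; apply/eqP.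
have /tensor_rel0 := TensorDr m (a *: n) n'.
have /tensor_rel0 := TensorZr a m n.
rewrite !linearB /= linearZ /= => /eqP; rewrite subr_eq0 => /eqP <-.
by rewrite opprD addrA.
Qed.

Section TensorLift.
Variables (P : lmodType R) (b : M -> N -> P).
Hypotheses (bl : forall n, linear (b^~ n)) (br : forall m, linear (b m)).

Lemma tlift_subproof w :
  span tensor_rel w -> flift (fun p => b p.1 p.2) w = 0.
Proof.
elim=> [|a s v Ss _ IH]; first by rewrite raddf0.
rewrite linearP /= IH addr0; suff -> : flift (fun p => b p.1 p.2) s = 0.
  by rewrite scaler0.
case: Ss => [m m' n|m n n'|c m n|c m n]; rewrite !linearB /= ?linearZ /= !flift_basis /=.
- by have := bl n 1 m m'; rewrite !scale1r => ->; rewrite -addrA -opprD subrr.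
- by have := br m 1 n n'; rewrite !scale1r => ->; rewrite -addrA -opprD subrr.
- have := bl n c m 0; rewrite addr0 => ->.
  have := bl n (-1) 0 0; rewrite scaler0 addr0 scaleN1r addNr => ->.
  by rewrite addr0 scalerN subrr.
- have := br m c n 0; rewrite addr0 => ->.
  have := br m (-1) 0 0; rewrite scaler0 addr0 scaleN1r addNr => ->.
  by rewrite addr0 scalerN subrr.
Qed.

Definition tlift : {linear tensor -> P} := qlift tlift_subproof.

Lemma tliftE m n : tlift (tens m n) = b m n.
Proof. by rewrite /tlift qlift_pi /= flift_basis. Qed.

End TensorLift.
End Tensor.

Section TensorMap.
Variable R : comPzRingType.

Lemma tensor_ext (M N P : lmodType R) (f g : {linear tensor M N -> P}) :
  (forall m n, f (tens m n) = g (tens m n)) -> f =1 g.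
Proof.
move=> fg t; have [w ->] := qpi_surj t.
apply: (@freemod_ext _ _ _ (f \o qpi _) (g \o qpi _)) => -[m n]; exact: fg.
Qed.

Variables (M M' N N' : lmodType R).
Variables (f : {linear M -> M'}) (g : {linear N -> N'}).

Lemma tmap_linearl n : linear (fun m => tens (f m) (g n)).
Proof. by move=> a m m'; rewrite linearP tens_linearl. Qed.

Lemma tmap_linearr m : linear (fun n => tens (f m) (g n)).
Proof. by move=> a n n'; rewrite linearP tens_linearr. Qed.

Definition tmap : {linear tensor M N -> tensor M' N'} :=
  tlift tmap_linearl tmap_linearr.

Lemma tmapE m n : tmap (tens m n) = tens (f m) (g n).
Proof. exact: tliftE. Qed.

End TensorMap.

Section TensorMapTheory.
Variable R : comPzRingType.

Lemma tmap_comp (M M' M'' N N' N'' : lmodType R)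
    (f' : {linear M' -> M''}) (f : {linear M -> M'})
    (g' : {linear N' -> N''}) (g : {linear N -> N'}) t :
  tmap f' g' (tmap f g t) = tmap (f' \o f) (g' \o g) t.
Proof.
apply: (@tensor_ext _ _ _ _ (tmap f' g' \o tmap f g)) => m n.
by rewrite -[LHS]/(tmap f' g' (tmap f g (tens m n))) !tmapE.
Qed.

Lemma eq_tmap (M M' N N' : lmodType R) (f f' : {linear M -> M'})
    (g g' : {linear N -> N'}) : f =1 f' -> g =1 g' -> tmap f g =1 tmap f' g'.
Proof. by move=> ff gg; apply: tensor_ext => m n; rewrite !tmapE ff gg. Qed.

Lemma tens0l (M N : lmodType R) (n : N) : tens (0 : M) n = 0.
Proof.
have := tens_linearl n (-1) (0 : M) 0.
by rewrite scaler0 addr0 scaleN1r addNr.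
Qed.

Lemma tens0r (M N : lmodType R) (m : M) : tens m (0 : N) = 0.
Proof.
have := tens_linearr m (-1) (0 : N) 0.
by rewrite scaler0 addr0 scaleN1r addNr.
Qed.

Lemma tmap0l (M M' N N' : lmodType R) (f : {linear M -> M'})
    (g : {linear N -> N'}) t : (forall m, f m = 0) -> tmap f g t = 0.
Proof.
move=> f0; apply: (@tensor_ext _ _ _ _ (tmap f g) \0) => m n.
by rewrite tmapE f0 tens0l.
Qed.

Lemma tmap0r (M M' N N' : lmodType R) (f : {linear M -> M'})
    (g : {linear N -> N'}) t : (forall n, g n = 0) -> tmap f g t = 0.
Proof.
move=> g0; apply: (@tensor_ext _ _ _ _ (tmap f g) \0) => m n.
by rewrite tmapE g0 tens0r.
Qed.

End TensorMapTheory.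

Section DirectProduct.
Variables (R : pzRingType) (I : Type) (F : I -> lmodType R).

Definition dprod : Type := forall i, F i.
HB.instance Definition _ := gen_eqMixin dprod.
HB.instance Definition _ := gen_choiceMixin dprod.

Let add (f g : dprod) : dprod := fun i => f i + g i.
Let opp (f : dprod) : dprod := fun i => - f i.
Let scale (a : R) (f : dprod) : dprod := fun i => a *: f i.

Fact dprod_addA : associative add.
Proof. by move=> f g h; apply: functional_extensionality_dep => i; apply: addrA. Qed.
Fact dprod_addC : commutative add.
Proof. by move=> f g; apply: functional_extensionality_dep => i; apply: addrC. Qed.
Fact dprod_add0 : left_id ((fun i => 0) : dprod) add.
Proof. by move=> f; apply: functional_extensionality_dep => i; apply: add0r. Qed.
Fact dprod_addN : left_inverse ((fun i => 0) : dprod) opp add.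
Proof. by move=> f; apply: functional_extensionality_dep => i; apply: addNr. Qed.
HB.instance Definition _ := GRing.isZmodule.Build dprod
  dprod_addA dprod_addC dprod_add0 dprod_addN.

Fact dprod_scaleA a b f : scale a (scale b f) = scale (a * b) f.
Proof. by apply: functional_extensionality_dep => i; apply: scalerA. Qed.
Fact dprod_scale1 : left_id 1 scale.
Proof. by move=> f; apply: functional_extensionality_dep => i; apply: scale1r. Qed.
Fact dprod_scaleDr : right_distributive scale +%R.
Proof. by move=> a f g; apply: functional_extensionality_dep => i; apply: scalerDr. Qed.
Fact dprod_scaleDl f : {morph scale^~ f : a b / a + b}.
Proof. by move=> a b; apply: functional_extensionality_dep => i; apply: scalerDl. Qed.
HB.instance Definition _ := GRing.Zmodule_isLmodule.Build R dprod
  dprod_scaleA dprod_scale1 dprod_scaleDr dprod_scaleDl.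

End DirectProduct.

Section Complexes.
Variable R : comPzRingType.

Definition zeromod : lmodType R := 'rV[R]_0.

Record chain_complex := ChainComplex {
  ch_obj :> nat -> lmodType R;
  ch_d : forall n, {linear ch_obj n.+1 -> ch_obj n};
  ch_dd : forall n x, ch_d n (ch_d n.+1 x) = 0
}.

Record chain_map (C D : chain_complex) := ChainMap {
  cm_map :> forall n, {linear C n -> D n};
  cm_d : forall n x, cm_map n (ch_d C n x) = ch_d D n (cm_map n.+1 x)
}.

Record cochain_complex := CochainComplex {
  co_obj :> nat -> lmodType R;
  co_d : forall n, {linear co_obj n -> co_obj n.+1};
  co_dd : forall n x, co_d n.+1 (co_d n x) = 0
}.

Section Homology.
Variables (C : chain_complex) (n : nat).

Definition ch_cycle : C n -> Prop :=
  match n return C n -> Prop with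
  | 0 => fun _ => True
  | n'.+1 => fun x => ch_d C n' x = 0
  end.

Lemma ch_cycle0 : ch_cycle 0.
Proof. by rewrite /ch_cycle; case: n => //= n'; rewrite raddf0. Qed.

Lemma ch_cycleP a x y : ch_cycle x -> ch_cycle y -> ch_cycle (a *: x + y).
Proof.
rewrite /ch_cycle; case: n x y => //= n' x y dx dy.
by rewrite linearP dx dy scaler0 addr0.
Qed.

Definition ch_cycles := submod (Submodule ch_cycle0 ch_cycleP).
HB.instance Definition _ := GRing.Lmodule.on ch_cycles.

Definition ch_boundary (z : ch_cycles) := exists y, submod_val z = ch_d C n y.

Lemma ch_boundary0 : ch_boundary 0.
Proof. by exists 0; rewrite !raddf0. Qed.

Lemma ch_boundaryP a x y :
  ch_boundary x -> ch_boundary y -> ch_boundary (a *: x + y).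
Proof.
by move=> [u xu] [v yv]; exists (a *: u + v); rewrite !linearP /= xu yv.
Qed.

Definition homology := quotmod (Submodule ch_boundary0 ch_boundaryP).
HB.instance Definition _ := GRing.Lmodule.on homology.

End Homology.

Section HomologyMap.
Variables (C D : chain_complex) (f : chain_map C D) (n : nat).

Lemma hmap_cycle_subproof (z : ch_cycles C n) :
  f n (submod_val z) \in smemb (Submodule (@ch_cycle0 D n) (@ch_cycleP D n)).
Proof.
apply/asboolP; case: z => z /= /asboolP /=; rewrite /ch_cycle.
by case: n z => //= n' z dz; rewrite -cm_d dz raddf0.
Qed.

Definition hmap_cycle (z : ch_cycles C n) : homology D n :=
  qpi _ (Submod (hmap_cycle_subproof z)).

Lemma hmap_cycle_linear : linear hmap_cycle.
Proof.
move=> a x y; rewrite /hmap_cycle -linearP; congr qpi.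
by apply: val_inj; rewrite /= !linearP.
Qed.
HB.instance Definition _ := GRing.isLinear.Build R (ch_cycles C n)
  (homology D n) *:%R hmap_cycle hmap_cycle_linear.

Lemma hmap_subproof (z : ch_cycles C n) : ch_boundary z -> hmap_cycle z = 0.
Proof.
move=> [y zy]; rewrite -(raddf0 (qpi _)); apply/qpi_eq; rewrite subr0.
by exists (f n.+1 y); rewrite /= zy cm_d.
Qed.

Definition homology_map : {linear homology C n -> homology D n} :=
  @qlift _ _ (Submodule (@ch_boundary0 C n) (@ch_boundaryP C n)) _ hmap_cycle
    hmap_subproof.

End HomologyMap.

Section Cohomology.
Variables (C : cochain_complex) (n : nat).

Definition co_cycle (x : C n) := co_d C n x = 0.

Lemma co_cycle0 : co_cycle 0.
Proof. exact: raddf0. Qed.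

Lemma co_cycleP a x y : co_cycle x -> co_cycle y -> co_cycle (a *: x + y).
Proof. by rewrite /co_cycle linearP => -> ->; rewrite scaler0 addr0. Qed.

Definition co_cycles := submod (Submodule co_cycle0 co_cycleP).
HB.instance Definition _ := GRing.Lmodule.on co_cycles.

Definition co_bound : C n -> Prop :=
  match n return C n -> Prop with
  | 0 => fun x => x = 0
  | n'.+1 => fun x => exists y, x = co_d C n' y
  end.
Definition co_boundary (z : co_cycles) := co_bound (submod_val z).

Lemma co_boundary0 : co_boundary 0.
Proof.
rewrite /co_boundary raddf0 /co_bound; case: n => //= n'.
by exists 0; rewrite raddf0.
Qed.

Lemma co_boundaryP a x y :
  co_boundary x -> co_boundary y -> co_boundary (a *: x + y).
Proof.
rewrite /co_boundary linearP /=; case: x y => [x _] [y _] /=.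
rewrite /co_bound; case: n x y => [x y -> ->|n' x y [u ->] [v ->]] /=.
  by rewrite scaler0 addr0.
by exists (a *: u + v); rewrite linearP.
Qed.

Definition cohomology := quotmod (Submodule co_boundary0 co_boundaryP).
HB.instance Definition _ := GRing.Lmodule.on cohomology.

End Cohomology.

(* chain2 f and cochain2 f are the complexes with f : A -> B as their only
   differential, with A in degree 1 and B in degree 0 for chain2, and A in
   degree 0 and B in degree 1 for cochain2; chain1 A and cochain1 A are A
   concentrated in degree 0. *)
Section TwoTerm.
Variables (A B : lmodType R).

Definition two_term_obj (M0 M1 : lmodType R) (n : nat) : lmodType R :=
  match n with 0 => M0 | 1 => M1 | _ => zeromod end.

Definition chain2_d (f : {linear A -> B}) n :
    {linear two_term_obj B A n.+1 -> two_term_obj B A n} :=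
  match n with 0 => f | _ => \0 end.

Lemma chain2_dd f n x : chain2_d f n (chain2_d f n.+1 x) = 0.
Proof. by case: n x => [|n] x //=; rewrite raddf0. Qed.

Definition chain2 (f : {linear A -> B}) : chain_complex :=
  ChainComplex (chain2_dd f).

Definition cochain2_d (f : {linear A -> B}) n :
    {linear two_term_obj A B n -> two_term_obj A B n.+1} :=
  match n with 0 => f | _ => \0 end.

Lemma cochain2_dd f n x : cochain2_d f n.+1 (cochain2_d f n x) = 0.
Proof. by []. Qed.

Definition cochain2 (f : {linear A -> B}) : cochain_complex :=
  CochainComplex (cochain2_dd f).

Definition one_term_obj (n : nat) : lmodType R := if n is 0 then A else zeromod.

Definition chain1 : chain_complex :=
  @ChainComplex one_term_obj (fun _ => \0) (fun _ _ => erefl).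
Definition cochain1 : cochain_complex :=
  @CochainComplex one_term_obj (fun _ => \0) (fun _ _ => erefl).

End TwoTerm.

(* Degree n of a tensor product of complexes is the direct sum of the
   C_i (x) D_j with i + j = n, written as a product because there are finitely
   many such (i, j). The differential is
   d (c (x) e) = dc (x) e + (-1)^i c (x) de for c in degree i. *)
Definition bideg_pred (n : nat) (p : nat * nat) : bool := (p.1 + p.2)%N == n.
Definition bideg n := {p : nat * nat | bideg_pred n p}.

Lemma bidegSl_subproof n (p : bideg n) :
  bideg_pred n.+1 ((sval p).1.+1, (sval p).2).
Proof. exact: (proj2_sig p). Qed.

Lemma bidegSr_subproof n (p : bideg n) :
  bideg_pred n.+1 ((sval p).1, (sval p).2.+1).
Proof. by rewrite /bideg_pred /= addnS; exact: (proj2_sig p). Qed.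

Lemma bideg_predSr n i j : bideg_pred n.+1 (i, j.+1) -> bideg_pred n (i, j).
Proof. by rewrite /bideg_pred /= addnS. Qed.

Definition bidegSl n (p : bideg n) : bideg n.+1 :=
  exist (bideg_pred n.+1) ((sval p).1.+1, (sval p).2) (bidegSl_subproof p).
Definition bidegSr n (p : bideg n) : bideg n.+1 :=
  exist (bideg_pred n.+1) ((sval p).1, (sval p).2.+1) (bidegSr_subproof p).

Lemma bideg_irr (G : nat -> nat -> Type) n
    (f : forall p : bideg n, G (sval p).1 (sval p).2) q (e e' : bideg_pred n q) :
  f (exist (bideg_pred n) q e) = f (exist (bideg_pred n) q e').
Proof. by rewrite (bool_irrelevance e e'). Qed.

Section ChainTensor.
Variables C D : chain_complex.

Definition ctens_obj (n : nat) : lmodType R :=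
  dprod (fun p : bideg n => tensor (C (sval p).1) (D (sval p).2) : lmodType R).

(* The (i, j) component of the differential receives the components of degree
   (i + 1, j) and (i, j + 1). *)
Definition ctens_dfun n (f : ctens_obj n.+1) : ctens_obj n := fun p =>
  tmap (ch_d C (sval p).1) idfun (f (bidegSl p)) +
  (-1) ^+ (sval p).1 *: tmap idfun (ch_d D (sval p).2) (f (bidegSr p)).

Lemma ctens_d_linear n : linear (@ctens_dfun n).
Proof.
move=> a f g; apply: functional_extensionality_dep => p.
rewrite -[RHS]/(a *: ctens_dfun f p + ctens_dfun g p) /ctens_dfun.
rewrite -[(a *: f + g) (bidegSl p)]/(a *: f (bidegSl p) + g (bidegSl p)).
rewrite -[(a *: f + g) (bidegSr p)]/(a *: f (bidegSr p) + g (bidegSr p)).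
rewrite !(linearP (tmap _ _)) !scalerDr !scalerA [(-1) ^+ _ * a]mulrC.
exact: addrACA.
Qed.
HB.instance Definition _ n := GRing.isLinear.Build R (ctens_obj n.+1)
  (ctens_obj n) *:%R (@ctens_dfun n) (@ctens_d_linear n).

Definition ctens_d n : {linear ctens_obj n.+1 -> ctens_obj n} := @ctens_dfun n.

Lemma ctens_dd n f : ctens_d n (ctens_d n.+1 f) = 0.
Proof.
apply: functional_extensionality_dep => p.
rewrite -[LHS]/(tmap (ch_d C (sval p).1) idfun
   (tmap (ch_d C (sval p).1.+1) idfun (f (bidegSl (bidegSl p))) +
    (-1) ^+ (sval p).1.+1 *:
      tmap idfun (ch_d D (sval p).2) (f (bidegSr (bidegSl p)))) +
  (-1) ^+ (sval p).1 *: tmap idfun (ch_d D (sval p).2)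
   (tmap (ch_d C (sval p).1) idfun (f (bidegSl (bidegSr p))) +
    (-1) ^+ (sval p).1 *:
      tmap idfun (ch_d D (sval p).2.+1) (f (bidegSr (bidegSr p))))).
rewrite !linearD !linearZ_LR !tmap_comp.
rewrite [tmap (_ \o ch_d C _.+1) _ _]tmap0l ?add0r; last by move=> x; exact: ch_dd.
rewrite [tmap _ (_ \o ch_d D _.+1) _]tmap0r ?scaler0 ?addr0; last first.
  by move=> x; exact: ch_dd.
have -> : f (bidegSr (bidegSl p)) = f (bidegSl (bidegSr p))
    :> tensor (C (sval p).1.+1) (D (sval p).2.+1).
  exact: (@bideg_irr (fun i j => tensor (C i) (D j)) n.+2 f
    ((sval p).1.+1, (sval p).2.+1)
    (bidegSr_subproof (bidegSl p)) (bidegSl_subproof (bidegSr p))).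
rewrite (@eq_tmap _ _ _ _ _ (ch_d C (sval p).1 \o idfun)
  (idfun \o ch_d C (sval p).1) (idfun \o ch_d D (sval p).2)
  (ch_d D (sval p).2 \o idfun)) //.
rewrite exprS mulN1r scaleNr raddf0 scaler0 addr0; exact: addNr.
Qed.

Definition ctens : chain_complex := ChainComplex ctens_dd.

End ChainTensor.

Section ChainTensorMap.
Variables (C C' D D' : chain_complex) (f : chain_map C C') (g : chain_map D D').

Definition ctens_mapfun n (u : ctens C D n) : ctens C' D' n := fun p =>
  tmap (f (sval p).1) (g (sval p).2) (u p).

Lemma ctens_map_linear n : linear (@ctens_mapfun n).
Proof.
move=> a u v; apply: functional_extensionality_dep => p.
exact: (linearP (tmap (f (sval p).1) (g (sval p).2))).
Qed.
HB.instance Definition _ n := GRing.isLinear.Build R (ctens C D n)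
  (ctens C' D' n) *:%R (@ctens_mapfun n) (@ctens_map_linear n).

Lemma ctens_map_d n u :
  @ctens_mapfun n (ch_d (ctens C D) n u) =
  ch_d (ctens C' D') n (@ctens_mapfun n.+1 u).
Proof.
apply: functional_extensionality_dep => p.
rewrite -[LHS]/(tmap (f (sval p).1) (g (sval p).2)
  (tmap (ch_d C (sval p).1) idfun (u (bidegSl p)) +
   (-1) ^+ (sval p).1 *: tmap idfun (ch_d D (sval p).2) (u (bidegSr p)))).
rewrite -[RHS]/(tmap (ch_d C' (sval p).1) idfun
     (tmap (f (sval p).1.+1) (g (sval p).2) (u (bidegSl p))) +
   (-1) ^+ (sval p).1 *: tmap idfun (ch_d D' (sval p).2)
     (tmap (f (sval p).1) (g (sval p).2.+1) (u (bidegSr p)))).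
rewrite linearD linearZ_LR !tmap_comp.
congr (_ + _ *: _); apply: eq_tmap => x //=; exact: cm_d.
Qed.

Definition ctens_map : chain_map (ctens C D) (ctens C' D') :=
  @ChainMap _ _ (fun n => @ctens_mapfun n) ctens_map_d.

End ChainTensorMap.

Section CochainTensor.
Variables C D : cochain_complex.

Definition cotens_obj (n : nat) : lmodType R :=
  dprod (fun p : bideg n => tensor (C (sval p).1) (D (sval p).2) : lmodType R).

Definition cotens_dl n (f : cotens_obj n) i j :
    bideg_pred n.+1 (i, j) -> tensor (C i) (D j) :=
  match i with
  | 0 => fun _ => 0
  | i'.+1 => fun e =>
      tmap (co_d C i') idfun (f (exist (bideg_pred n) (i', j) e))
  end.

Definition cotens_dr n (f : cotens_obj n) i j :
    bideg_pred n.+1 (i, j) -> tensor (C i) (D j) :=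
  match j with
  | 0 => fun _ => 0
  | j'.+1 => fun e =>
      (-1) ^+ i *: tmap idfun (co_d D j') 
        (f (exist (bideg_pred n) (i, j') (bideg_predSr e)))
  end.

Definition cotens_dfun n (f : cotens_obj n) : cotens_obj n.+1 := fun p =>
  @cotens_dl n f (sval p).1 (sval p).2 (proj2_sig p) +
  @cotens_dr n f (sval p).1 (sval p).2 (proj2_sig p).

Lemma cotens_d_linear n : linear (@cotens_dfun n).
Proof.
move=> a f g; apply: functional_extensionality_dep => p.
have El : cotens_dl (a *: f + g) (proj2_sig p) =
    a *: cotens_dl f (proj2_sig p) + cotens_dl g (proj2_sig p).
  move: (proj2_sig p); case: (sval p) => -[|i] j e /=; first by rewrite scaler0 addr0.
  exact: (linearP (tmap (co_d C i) idfun)).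
have Er : cotens_dr (a *: f + g) (proj2_sig p) =
    a *: cotens_dr f (proj2_sig p) + cotens_dr g (proj2_sig p).
  move: (proj2_sig p); case: (sval p) => i [|j] e; first by rewrite /= scaler0 addr0.
  pose q := exist (bideg_pred n) (i, j) (bideg_predSr e).
  rewrite -[LHS]/((-1) ^+ i *: tmap idfun (co_d D j) (a *: f q + g q)).
  rewrite (linearP (tmap _ _)) scalerDr scalerA mulrC -scalerA.
  by [].
rewrite -[LHS]/(cotens_dl (a *: f + g) (proj2_sig p) +
                cotens_dr (a *: f + g) (proj2_sig p)) El Er.
rewrite -[RHS]/(a *: (cotens_dl f (proj2_sig p) + cotens_dr f (proj2_sig p)) +
                (cotens_dl g (proj2_sig p) + cotens_dr g (proj2_sig p))).
by rewrite scalerDr; apply: addrACA.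
Qed.
HB.instance Definition _ n := GRing.isLinear.Build R (cotens_obj n)
  (cotens_obj n.+1) *:%R (@cotens_dfun n) (@cotens_d_linear n).

Definition cotens_d n : {linear cotens_obj n -> cotens_obj n.+1} := @cotens_dfun n.

Lemma cotens_dd n f : cotens_d n.+1 (cotens_d n f) = 0.
Proof.
apply: functional_extensionality_dep => -[[i j] e].
rewrite -[LHS]/(@cotens_dl n.+1 (cotens_dfun f) i j e +
                @cotens_dr n.+1 (cotens_dfun f) i j e) -[RHS]/(0 : tensor _ _).
have dl0 k l (e' : bideg_pred n.+1 (k, l)) :
    tmap (co_d C k) idfun (cotens_dl f e') = 0 :> tensor (C k.+1) (D l).
  case: k e' => [|k] e'; first exact: (linear0 (tmap _ _)).
  pose q := exist (bideg_pred n) (k, l) e'.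
  rewrite -[LHS]/(tmap (co_d C k.+1) idfun (tmap (co_d C k) idfun (f q))).
  by rewrite tmap_comp; apply: tmap0l => x; exact: co_dd.
have dr0 k l (e' : bideg_pred n.+1 (k, l)) :
    tmap idfun (co_d D l) (cotens_dr f e') = 0 :> tensor (C k) (D l.+1).
  case: l e' => [|l] e'; first exact: (linear0 (tmap _ _)).
  pose q := exist (bideg_pred n) (k, l) (bideg_predSr e').
  rewrite -[LHS]/(tmap idfun (co_d D l.+1)
    ((-1) ^+ k *: tmap idfun (co_d D l) (f q))).
  by rewrite linearZ_LR tmap_comp tmap0r ?scaler0 // => x; exact: co_dd.
have El k (e' : bideg_pred n.+2 (k.+1, j)) :
    cotens_dl (cotens_dfun f) e' =
    tmap (co_d C k) idfun (@cotens_dr n f k j e') :> tensor (C k.+1) (D j).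
  rewrite -[LHS]/(tmap (co_d C k) idfun
    (@cotens_dl n f k j e' + @cotens_dr n f k j e')).
  by rewrite linearD dl0 add0r.
have Er l (e' : bideg_pred n.+2 (i, l.+1)) :
    cotens_dr (cotens_dfun f) e' = (-1) ^+ i *:
    tmap idfun (co_d D l) (@cotens_dl n f i l (bideg_predSr e')) :>
    tensor (C i) (D l.+1).
  rewrite -[LHS]/((-1) ^+ i *: tmap idfun (co_d D l)
    (@cotens_dl n f i l (bideg_predSr e') + @cotens_dr n f i l (bideg_predSr e'))).
  by rewrite linearD dr0 addr0.
case: i j e El Er => [|i] [|j] e El Er.
- exact: addr0.
- rewrite Er -[cotens_dl _ (bideg_predSr e)]/(0 : tensor (C 0) (D j)).
  by rewrite linear0 scaler0; exact: addr0.
- rewrite El -[@cotens_dr n f i 0 e]/(0 : tensor (C i) (D 0)) linear0.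
  exact: addr0.
pose q := exist (bideg_pred n) (i, j) (@bideg_predSr n i j e).
pose q' := exist (bideg_pred n) (i, j) (bideg_predSr (n := n.+1) (i := i.+1) e).
rewrite El Er -[cotens_dr f _]/((-1) ^+ i *: tmap idfun (co_d D j) (f q)).
rewrite -[cotens_dl f _]/(tmap (co_d C i) idfun (f q')).
rewrite linearZ_LR !tmap_comp exprS mulN1r scaleNr.
rewrite (@eq_tmap _ _ _ _ _ (co_d C i \o idfun) (idfun \o co_d C i)
  (idfun \o co_d D j) (co_d D j \o idfun)) //.
have -> : f q = f q'.
  exact: (@bideg_irr (fun k l => tensor (C k) (D l))).
exact: subrr.
Qed.

Definition cotens : cochain_complex := CochainComplex cotens_dd.

End CochainTensor.
End Complexes.

Section Localization.
Variables (R : comPzRingType) (x : R).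

(* (a, n) stands for a / x ^ n *)
Definition loc_eqv : rel (R * nat) := fun u v =>
  `[< exists k, x ^+ k * (x ^+ v.2 * u.1) = x ^+ k * (x ^+ u.2 * v.1) >].

Lemma loc_eqv_equiv : equiv_class_of loc_eqv.
Proof.
split=> [u|u v|v u w]; first by apply/asboolP; exists 0.
  by apply/asboolP/asboolP => -[k e]; exists k.
move: v u w => [b m] [a n] [c p] /asboolP[k e] /asboolP[l e']; apply/asboolP; exists (m + k + l)%N.
rewrite /= in e e' *; transitivity (x ^+ l * x ^+ p * (x ^+ k * (x ^+ m * a))); first by rewrite ?exprD; ring.
rewrite e.
transitivity (x ^+ k * x ^+ n * (x ^+ l * (x ^+ p * b))); first by rewrite ?exprD; ring.
by rewrite e' ?exprD; ring.
Qed.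

Canonical loc_eqv_rel := EquivRelPack loc_eqv_equiv.
Canonical loc_eqv_enc := defaultEncModRel loc_eqv.

(* Only the R-module structure of R_x is needed. *)
Definition loc := {eq_quot loc_eqv}.
HB.instance Definition _ := Choice.on loc.

Definition frac (a : R) (n : nat) : loc := \pi_loc (a, n).

Lemma frac_eq a n b m : frac a n = frac b m <->
  exists k, x ^+ k * (x ^+ m * a) = x ^+ k * (x ^+ n * b).
Proof.
have e : (frac a n == frac b m) = loc_eqv (a, n) (b, m).
  by rewrite /frac; apply: (@eqquotE _ loc_eqv).
by split=> [/eqP|ex]; [rewrite e => /asboolP|apply/eqP; rewrite e; apply/asboolP].
Qed.

Lemma frac_surj (q : loc) : exists a n, q = frac a n.
Proof. by exists (repr q).1, (repr q).2; rewrite /frac -surjective_pairing reprK. Qed.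

Definition loc_add (p q : loc) : loc :=
  let: (a, n) := repr p in let: (b, m) := repr q in
  frac (x ^+ m * a + x ^+ n * b) (n + m).
Definition loc_opp (p : loc) : loc := let: (a, n) := repr p in frac (- a) n.
Definition loc_scale (c : R) (p : loc) : loc :=
  let: (a, n) := repr p in frac (c * a) n.

Lemma loc_addE a n b m :
  loc_add (frac a n) (frac b m) = frac (x ^+ m * a + x ^+ n * b) (n + m).
Proof.
rewrite /loc_add.
case Ep: (repr (frac a n)) => [a' n']; case Eq: (repr (frac b m)) => [b' m'].
have /frac_eq[k e] : frac a' n' = frac a n by rewrite /frac -Ep reprK.
have /frac_eq[l e'] : frac b' m' = frac b m by rewrite /frac -Eq reprK.
apply/frac_eq; exists (k + l)%N.
transitivity (x ^+ l * x ^+ m * x ^+ m' * (x ^+ k * (x ^+ n * a')) +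
  x ^+ k * x ^+ n * x ^+ n' * (x ^+ l * (x ^+ m * b'))); first by rewrite ?exprD; ring.
by rewrite e e' ?exprD; ring.
Qed.

Lemma loc_oppE a n : loc_opp (frac a n) = frac (- a) n.
Proof.
rewrite /loc_opp; case Ep: (repr (frac a n)) => [a' n'].
have /frac_eq[k e] : frac a' n' = frac a n by rewrite /frac -Ep reprK.
by apply/frac_eq; exists k; rewrite !mulrN e.
Qed.

Lemma loc_scaleE c a n : loc_scale c (frac a n) = frac (c * a) n.
Proof.
rewrite /loc_scale; case Ep: (repr (frac a n)) => [a' n'].
have /frac_eq[k e] : frac a' n' = frac a n by rewrite /frac -Ep reprK.
apply/frac_eq; exists k.
transitivity (c * (x ^+ k * (x ^+ n * a'))); first by rewrite ?exprD; ring.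
by rewrite e ?exprD; ring.
Qed.

Fact loc_addA : associative loc_add.
Proof.
move=> p q r; have [a [n ->]] := frac_surj p; have [b [m ->]] := frac_surj q.
have [c [l ->]] := frac_surj r; rewrite !loc_addE addnA; congr frac.
by rewrite ?exprD; ring.
Qed.

Fact loc_addC : commutative loc_add.
Proof.
move=> p q; have [a [n ->]] := frac_surj p; have [b [m ->]] := frac_surj q.
by rewrite !loc_addE addnC addrC.
Qed.

Fact loc_add0 : left_id (frac 0 0) loc_add.
Proof.
move=> p; have [a [n ->]] := frac_surj p.
by rewrite loc_addE mulr0 add0r expr0 mul1r.
Qed.

Fact loc_addN : left_inverse (frac 0 0) loc_opp loc_add.
Proof.
move=> p; have [a [n ->]] := frac_surj p; rewrite loc_oppE loc_addE.
by apply/frac_eq; exists 0; rewrite mulrN addNr !mulr0.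
Qed.

HB.instance Definition _ :=
  GRing.isZmodule.Build loc loc_addA loc_addC loc_add0 loc_addN.

Fact loc_scaleA c d p : loc_scale c (loc_scale d p) = loc_scale (c * d) p.
Proof. by have [a [n ->]] := frac_surj p; rewrite !loc_scaleE mulrA. Qed.

Fact loc_scale1 : left_id 1 loc_scale.
Proof. by move=> p; have [a [n ->]] := frac_surj p; rewrite loc_scaleE mul1r. Qed.

Fact loc_scaleDr : right_distributive loc_scale +%R.
Proof.
move=> c p q; have [a [n ->]] := frac_surj p; have [b [m ->]] := frac_surj q.
rewrite -![_ + _]/(loc_add _ _) !loc_scaleE !loc_addE loc_scaleE.
by congr frac; rewrite ?exprD; ring.
Qed.

Fact loc_scaleDl p : {morph loc_scale^~ p : c d / c + d}.
Proof.
move=> c d; have [a [n ->]] := frac_surj p.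
rewrite !loc_scaleE -[RHS]/(loc_add _ _) loc_addE.
by apply/frac_eq; exists 0; rewrite ?exprD; ring.
Qed.

HB.instance Definition _ := GRing.Zmodule_isLmodule.Build R loc
  loc_scaleA loc_scale1 loc_scaleDr loc_scaleDl.

Definition loc_map (a : R^o) : loc := frac a 0.

Lemma loc_map_linear : linear loc_map.
Proof.
move=> c a b; rewrite /loc_map -[RHS]/(loc_add (loc_scale c _) _).
by rewrite loc_scaleE loc_addE !expr0 !mul1r.
Qed.
HB.instance Definition _ :=
  GRing.isLinear.Build R R^o loc *:%R loc_map loc_map_linear.

End Localization.

Section HomModule.
Variables (R : comPzRingType) (M E : lmodType R).

Definition linear_pred (f : M -> E) : Prop := linear f.

Lemma linear_pred0 : linear_pred 0.
Proof. by move=> a x y; rewrite /= scaler0 addr0. Qed.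

Lemma linear_predP a f g :
  linear_pred f -> linear_pred g -> linear_pred (a *: f + g).
Proof.
move=> lf lg b x y.
rewrite -[LHS]/(a *: f (b *: x + y) + g (b *: x + y)) lf lg.
rewrite -[RHS]/(b *: (a *: f x + g x) + (a *: f y + g y)).
by rewrite !scalerDr !scalerA [b * a]mulrC addrACA.
Qed.

Definition homod : lmodType R := submod (Submodule linear_pred0 linear_predP).

End HomModule.

Definition injective_module (R : comPzRingType) (E : lmodType R) : Prop :=
  forall (A B : lmodType R) (i : {linear A -> B}) (f : {linear A -> E}),
    injective i -> exists g : {linear B -> E}, forall a, g (i a) = f a.

Section KoszulCech.
Variable R : comPzRingType.
Implicit Types (x : R) (xs : seq R) (M N : lmodType R).

Definition mulmap (a : R) : {linear R^o -> R^o} := *:%R a.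

Definition koszul1 x : chain_complex R := chain2 (mulmap x).

Section KoszulPower.
Variables (x : R) (n m : nat) (le_nm : (n <= m)%N).

Definition koszul1_map_fun i :
    {linear koszul1 (x ^+ m) i -> koszul1 (x ^+ n) i} :=
  match i with
  | 0 => idfun
  | 1 => mulmap (x ^+ (m - n))
  | _ => \0
  end.

Lemma koszul1_map_d i z :
  koszul1_map_fun i (ch_d (koszul1 (x ^+ m)) i z) =
  ch_d (koszul1 (x ^+ n)) i (koszul1_map_fun i.+1 z).
Proof.
case: i z => [|[|i]] z //=; last by rewrite /= raddf0.
  by rewrite scalerA -exprD subnKC.
Qed.

Definition koszul1_map := ChainMap koszul1_map_d.

End KoszulPower.

(* K(x_1, R) (x) (K(x_2, R) (x) (... (x) (K(x_l, R) (x) M))); the Cech complex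
   below is bracketed in the same way. *)
Definition koszul xs M : chain_complex R :=
  foldr (fun x C => ctens (koszul1 x) C) (chain1 M) xs.

Definition powers xs m : seq R := [seq x ^+ m | x <- xs].

Fixpoint koszul_map n m (le_nm : (n <= m)%N) xs M :
    chain_map (koszul (powers xs m) M) (koszul (powers xs n) M) :=
  match xs with
  | [::] => @ChainMap R (chain1 M) (chain1 M) (fun _ => idfun) (fun _ _ => erefl)
  | x :: xs' => ctens_map (koszul1_map x le_nm) (koszul_map le_nm xs' M)
  end.

Definition weakly_proregular xs M : Prop :=
  forall n, exists (m : nat) (le_nm : (n <= m)%N), forall i, (0 < i)%N ->
    forall h, homology_map (koszul_map le_nm xs M) i h = 0.

Definition cech1 x : cochain_complex R := cochain2 (@loc_map R x).

Definition cech xs N : cochain_complex R :=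
  foldr (fun x C => cotens (cech1 x) C) (cochain1 N) xs.

Definition cech_cohomology xs N i : lmodType R := cohomology (cech xs N) i.

End KoszulCech.

(* Main.v *)
From HB Require Import structures.
Require Import Defs.
From mathcomp Require Import all_boot all_algebra.
From mathcomp Require Import boolp functions classical_sets.
From mathcomp Require Import ring zify.

Set Implicit Arguments.
Unset Strict Implicit.
Unset Printing Implicit Defensive.

Import GRing.Theory Num.Theory.
Local Open Scope ring_scope.

(** The Koszul complexes K_n = K(x^n, M) form an inverse system, and for a
    module E the Cech complex of Hom(M, E) is the direct limit of the cochain
    complexes Hom(K_n, E). For a single element x this is the description of
    R_x (x) C as the limit of C -> C -> C -> ..., all maps being multiplication
    by x, where c in the n-th copy stands for (1 / x^n) (x) c; the general case
    follows by induction on the sequence, one tensor factor at a time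
    ([cone_presentation], [cech_presentation]).

    If E is injective, Hom(-, E) is exact, so H^i of the limit is the limit of
    the modules Hom(H_i(x^n, M), E). When every H_i(x^n, M) is killed by some
    transition map H_i(x^m, M) -> H_i(x^n, M), this limit vanishes
    ([cech_exact_of_weakly_proregular]). Conversely, embed H_i(x^n, M) into an
    injective module E ([enough_injectives]). The embedding is an element of
    the n-th module of the system Hom(H_i(x^m, M), E); if the limit is zero, it
    dies at some stage m, which says that H_i(x^m, M) -> H_i(x^n, M) -> E is
    zero, hence so is its first factor ([homology_dies]). One m serves all
    degrees because H_i vanishes for i larger than the length of the sequence
    ([koszul_vanish], [homology_dies_uniformly]).

    The limit is handled through elements: [colim_presentation] records maps
    Hom(K_n, E) -> C that commute with everything, are jointly surjective, and
    kill only what dies at a later stage. Injective modules are products of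
    copies of Hom_Z(R, Q/Z), where Q/Z is injective over Z by Zorn's lemma
    ([partial_additive_extend]). *)

(** * Homomorphism modules *)
Section Hom.
Variables (R : comPzRingType) (E : lmodType R).

Definition happ (A : lmodType R) (g : homod A E) : A -> E := submod_val g.

Lemma happ_linear (A : lmodType R) (g : homod A E) : linear (happ g).
Proof. exact: asboolW (submod_valP g). Qed.
HB.instance Definition _ (A : lmodType R) (g : homod A E) :=
  GRing.isLinear.Build R A E *:%R (happ g) (happ_linear g).

Lemma homod_ext (A : lmodType R) (g h : homod A E) : happ g =1 happ h -> g = h.
Proof. by move=> gh; apply: val_inj; apply/funext. Qed.

Definition hom_of (A : lmodType R) (f : {linear A -> E}) : homod A E :=
  Submod (asboolT (linearP f) :
    (f : A -> E) \in smemb (Submodule (@linear_pred0 R A E) (@linear_predP R A E))).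

Lemma hom_ofE (A : lmodType R) (f : {linear A -> E}) z : happ (hom_of f) z = f z.
Proof. by []. Qed.

Lemma happP (A : lmodType R) a (g h : homod A E) z :
  happ (a *: g + h) z = a *: happ g z + happ h z.
Proof. by []. Qed.

Lemma happZ (A : lmodType R) (g : homod A E) a z :
  happ g (a *: z) = a *: happ g z.
Proof. by rewrite linearZ. Qed.

Lemma happ_mapD (A B : lmodType R) (g : homod B E) (f : {linear A -> B}) a b :
  happ g (f (a + b)) = happ g (f a) + happ g (f b).
Proof. by rewrite !linearD. Qed.

Section Pre.
Variables (A B : lmodType R) (f : {linear A -> B}).
Definition hpre (g : homod B E) : homod A E := hom_of (happ g \o f).
Lemma hpreE g z : happ (hpre g) z = happ g (f z).
Proof. by []. Qed.
Lemma hpre_linear : linear hpre.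
Proof. by move=> a g h; apply: homod_ext => z; rewrite happP !hpreE happP. Qed.
HB.instance Definition _ :=
  GRing.isLinear.Build R (homod B E) (homod A E) *:%R hpre hpre_linear.
End Pre.
End Hom.

(** * Bigraded modules concentrated in two columns *)
Section Columns.
Variables (R : pzRingType) (G : nat -> nat -> lmodType R) (n : nat).
Local Notation total := (dprod (fun p : bideg n => G (sval p).1 (sval p).2)).

(** The value at q has type G indexed by q, so y must be transported along
    p = q; as equality of bidegrees is decidable, the transport along p = p is
    the identity. *)
Definition column_in (p : bideg n) (y : G (sval p).1 (sval p).2) : total := fun q =>
  if p =P q is ReflectT e
  then ecast q (G (sval q).1 (sval q).2) e y else 0.

Lemma column_in_same p y : column_in y p = y :> G (sval p).1 (sval p).2.
Proof. by rewrite /column_in; case: eqP => // e; rewrite eq_axiomK. Qed.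

Lemma column_in_other p q (y : G (sval p).1 (sval p).2) : p != q -> column_in y q = 0.
Proof. by rewrite /column_in; case: eqP. Qed.

Lemma column_in_linear p : linear (@column_in p).
Proof.
move=> a y z; apply: functional_extensionality_dep => q.
rewrite -[RHS]/(a *: column_in y q + column_in z q) /column_in.
by case: eqP => [e|_]; [case: q / e | rewrite scaler0 addr0].
Qed.
HB.instance Definition _ p :=
  GRing.isLinear.Build R _ total *:%R (@column_in p) (@column_in_linear p).

Definition column_pr (p : bideg n) (t : total) : G (sval p).1 (sval p).2 := t p.
Lemma column_pr_linear p : linear (column_pr p).
Proof. by []. Qed.
HB.instance Definition _ p :=
  GRing.isLinear.Build R total _ *:%R (@column_pr p) (@column_pr_linear p).

Definition column_inL p : {linear G (sval p).1 (sval p).2 -> total} := @column_in p.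
Definition column_prL p : {linear total -> G (sval p).1 (sval p).2} := @column_pr p.
End Columns.

Definition bideg0 n : bideg n := exist (bideg_pred n) (0, n) (eqxx n).
Definition bideg1 n : bideg n.+1 := exist (bideg_pred n.+1) (1, n) (eqxx n.+1).

Section TwoColumns.
Variables (R : pzRingType) (G : nat -> nat -> lmodType R).
Hypothesis G0 : forall i j (y : G i.+2 j), y = 0.
Local Notation total n := (dprod (fun p : bideg n => G (sval p).1 (sval p).2)).

Lemma total_ext0 (s t : total 0) : s (bideg0 0) = t (bideg0 0) -> s = t.
Proof.
move=> st; apply: functional_extensionality_dep => -[[[|i] [|j]] e] //.
by rewrite -!(bideg_irr (G := G) _ (eqxx 0 : bideg_pred 0 (0,0))).
Qed.

Lemma total_extS n (s t : total n.+1) :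
  s (bideg0 n.+1) = t (bideg0 n.+1) -> s (bideg1 n) = t (bideg1 n) -> s = t.
Proof.
move=> st0 st1; apply: functional_extensionality_dep => -[[[|[|i]] j] e].
- have ej := eqP e; rewrite /= add0n in ej; subst j.
  by rewrite -!(bideg_irr (G := G) _ (eqxx n.+1 : bideg_pred n.+1 (0,n.+1))).
- have [ej] := eqP e; rewrite /= ?add0n in ej; subst j.
  by rewrite -!(bideg_irr (G := G) _ (eqxx n.+1 : bideg_pred n.+1 (1,n))).
- by rewrite [LHS]G0 [RHS]G0.
Qed.
End TwoColumns.

(** * Tensor products with the base ring *)
Lemma tensZl (R : comPzRingType) (M N : lmodType R) a (m : M) (n : N) :
  tens (a *: m) n = a *: tens m n.
Proof. by have := tens_linearl n a m 0; rewrite addr0 tens0l addr0. Qed.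
Lemma tensZr (R : comPzRingType) (M N : lmodType R) a (m : M) (n : N) :
  tens m (a *: n) = a *: tens m n.
Proof. by have := tens_linearr m a n 0; rewrite addr0 tens0r addr0. Qed.
Lemma tensDr (R : comPzRingType) (M N : lmodType R) (m : M) (n n' : N) :
  tens m (n + n') = tens m n + tens m n'.
Proof. by have := tens_linearr m 1 n n'; rewrite !scale1r. Qed.


(** Every tensor is a sum of pure tensors, the coefficients being absorbed by
    the left factor. *)
Lemma tensor_ind (R : comPzRingType) (M N : lmodType R) (P : tensor M N -> Prop) :
  P 0 -> (forall m n t, P t -> P (tens m n + t)) -> forall t, P t.
Proof.
move=> P0 PS t; have [w ->] := qpi_surj t.
rewrite [w]freemod_decomp /flift linear_sum.
elim: (fsupp w) => [|[m n] s IH]; first by rewrite big_nil.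
rewrite big_cons (_ : _ (_ *: _) = tens (fcoef w (m, n) *: m) n).
  exact: PS.
by rewrite linearZ_LR tensZl.
Qed.

Section TensorUnit.
Variables (R : comPzRingType) (D : lmodType R).

Lemma tscale_linearl (d : D) : linear (fun a : R^o => (a : R) *: d).
Proof. by move=> c a b; rewrite scalerDl -scalerA. Qed.
Lemma tscale_linearr (a : R^o) : linear (fun d : D => (a : R) *: d).
Proof. by move=> c d e; rewrite scalerDr !scalerA [c * _]mulrC. Qed.

Definition tscale : {linear tensor R^o D -> D} := tlift tscale_linearl tscale_linearr.

Lemma tscaleE a d : tscale (tens a d) = (a : R) *: d.
Proof. exact: tliftE. Qed.

(** The map v |-> 1 (x) v is inverse to it, because a (x) v = 1 (x) (a v). *)
Lemma tscale_inj : injective tscale.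
Proof.
suff e t : t = tens (1 : R^o) (tscale t) by move=> s t st; rewrite (e s) (e t) st.
pose f : tensor R^o D -> tensor R^o D := fun t => tens (1 : R^o) (tscale t).
have fl : linear f by move=> a u v; rewrite /f linearP tens_linearr.
pose F : {linear tensor R^o D -> tensor R^o D} :=
  HB.pack f (GRing.isLinear.Build _ _ _ _ f fl).
apply: (@tensor_ext R R^o D _ idfun F) => a d.
rewrite -[RHS]/(tens (1 : R^o) (tscale (tens a d))) tscaleE /=.
by rewrite tensZr -tensZl [_ *: _]mulr1.
Qed.
End TensorUnit.
Arguments tscale {R D}.

Lemma tensor_zeromod (R : comPzRingType) (D : lmodType R) (t : tensor (zeromod R) D) : t = 0.
Proof.
apply: (@tensor_ext R (zeromod R) D _ idfun \0) => a d /=.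
by rewrite [a]thinmx0 tens0l.
Qed.

Section TensorUnitMap.
Variable R : comPzRingType.

Definition unitens (V : lmodType R) (v : V) : tensor R^o V := tens (1 : R^o) v.
Lemma unitens_linear (V : lmodType R) : linear (@unitens V).
Proof. exact: tens_linearr. Qed.
HB.instance Definition _ (V : lmodType R) :=
  GRing.isLinear.Build R V (tensor R^o V) *:%R (@unitens V) (@unitens_linear V).
Lemma tscale_unitens (V : lmodType R) (v : V) : tscale (unitens v) = v.
Proof. by rewrite tscaleE scale1r. Qed.

Definition lcomp (U V W : lmodType R) (f : {linear V -> W}) (g : {linear U -> V}) :
  {linear U -> W} := f \o g.

Lemma tscale_tmapl (V W : lmodType R) (f : {linear R^o -> R^o}) (g : {linear V -> W}) u :
  tscale (tmap f g u) = f 1 *: g (tscale u).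
Proof.
apply: (tensor_ext (f := @tscale R W \o tmap f g)
  (g := f 1 \*: (g \o @tscale R V))) => a v.
rewrite -[LHS]/(tscale (tmap f g (tens a v))) -[RHS]/(f 1 *: (g (tscale (tens a v)))).
rewrite tmapE !tscaleE linearZ scalerA /=; congr (_ *: _).
by rewrite mulrC -[_ * _]/(a *: f 1) -linearZ /= [_ *: _]mulr1.
Qed.

End TensorUnitMap.

(** * The Koszul complex as a mapping cone *)
Section KoszulCone.
Variables (R : comPzRingType) (x : R) (D : chain_complex R).
Local Notation T := (ctens (koszul1 x) D).
Local Notation G := (fun i j => tensor (koszul1 x i) (D j) : lmodType R).

Lemma koszul1_vanish i j (y : G i.+2 j) : y = 0.
Proof. exact: tensor_zeromod. Qed.

(** In degree n + 1 the complex T is D_{n+1} (+) D_n, and it is D_0 in degree 0: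
    [koszul_pr0], [koszul_pr1] are the projections and [koszul_in0],
    [koszul_in1] the inclusions. All later computations use only these maps and
    the formulas for the differential of T in terms of them. *)
Definition koszul_pr0 n : {linear T n -> D n} :=
  @lcomp _ (T n) _ _ (@tscale R (D n)) (@column_prL R G n (bideg0 n)).
Definition koszul_pr1 n : {linear T n.+1 -> D n} :=
  @lcomp _ (T n.+1) _ _ (@tscale R (D n)) (@column_prL R G n.+1 (bideg1 n)).

Definition koszul_in0 n : {linear D n -> T n} :=
  @lcomp _ _ _ (T n) (@column_inL R G n (bideg0 n)) (@unitens R (D n)).
Definition koszul_in1 n : {linear D n -> T n.+1} :=
  @lcomp _ _ _ (T n.+1) (@column_inL R G n.+1 (bideg1 n)) (@unitens R (D n)).

Lemma koszul_in0E n c q :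
  koszul_in0 n c q = @column_in R G n (bideg0 n) (unitens c) q.
Proof. by []. Qed.
Lemma koszul_in1E n c q :
  koszul_in1 n c q = @column_in R G n.+1 (bideg1 n) (unitens c) q.
Proof. by []. Qed.
Lemma koszul_pr0E n t : koszul_pr0 n t = tscale (t (bideg0 n)).
Proof. by []. Qed.
Lemma koszul_pr1E n t : koszul_pr1 n t = tscale (t (bideg1 n)).
Proof. by []. Qed.

Lemma koszul_pr0_in0 n c : koszul_pr0 n (koszul_in0 n c) = c.
Proof. by rewrite koszul_pr0E koszul_in0E column_in_same tscale_unitens. Qed.
Lemma koszul_pr1_in1 n c : koszul_pr1 n (koszul_in1 n c) = c.
Proof. by rewrite koszul_pr1E koszul_in1E column_in_same tscale_unitens. Qed.
Lemma koszul_pr0_in1 n c : koszul_pr0 n.+1 (koszul_in1 n c) = 0.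
Proof. by rewrite koszul_pr0E koszul_in1E column_in_other // raddf0. Qed.
Lemma koszul_pr1_in0 n c : koszul_pr1 n (koszul_in0 n.+1 c) = 0.
Proof. by rewrite koszul_pr1E koszul_in0E column_in_other // raddf0. Qed.

Lemma koszul_ext0 (s t : T 0) : koszul_pr0 0 s = koszul_pr0 0 t -> s = t.
Proof. by move=> /tscale_inj; apply: (@total_ext0 R G). Qed.
Lemma koszul_extS n (s t : T n.+1) :
  koszul_pr0 n.+1 s = koszul_pr0 n.+1 t -> koszul_pr1 n s = koszul_pr1 n t -> s = t.
Proof.
by move=> /tscale_inj s0 /tscale_inj; apply: (@total_extS R G koszul1_vanish).
Qed.

Lemma koszul_split0 (t : T 0) : t = koszul_in0 0 (koszul_pr0 0 t).
Proof. by apply: koszul_ext0; rewrite koszul_pr0_in0. Qed.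
Lemma koszul_splitS n (t : T n.+1) :
  t = koszul_in0 n.+1 (koszul_pr0 n.+1 t) + koszul_in1 n (koszul_pr1 n t).
Proof.
apply: koszul_extS; rewrite linearD.
  by rewrite koszul_pr0_in0 koszul_pr0_in1 addr0.
by rewrite koszul_pr1_in0 koszul_pr1_in1 add0r.
Qed.

Lemma koszul_pr0_d n t :
  koszul_pr0 n (ch_d T n t) = ch_d D n (koszul_pr0 n.+1 t) + x *: koszul_pr1 n t.
Proof.
rewrite -[LHS]/(tscale (tmap (mulmap x) idfun (t (bidegSl (bideg0 n))) +
  (-1) ^+ 0 *: tmap idfun (ch_d D n) (t (bidegSr (bideg0 n))))).
rewrite expr0 scale1r linearD !tscale_tmapl scale1r addrC; congr (_ + _); last first.
  congr (_ *: _); first exact: mulr1.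
  by rewrite koszul_pr1E; congr (tscale _); exact: (@bideg_irr G n.+1 t (1, n)).
by rewrite koszul_pr0E; congr (ch_d D n (tscale _)); exact: (@bideg_irr G n.+1 t (0, n.+1)).
Qed.

(** The sign is that of the tensor product differential in column 1. *)
Lemma koszul_pr1_d n t : koszul_pr1 n (ch_d T n.+1 t) = - ch_d D n (koszul_pr1 n.+1 t).
Proof.
rewrite -[LHS]/(tscale (tmap \0 idfun (t (bidegSl (bideg1 n))) +
  (-1) ^+ 1 *: tmap idfun (ch_d D n) (t (bidegSr (bideg1 n))))).
rewrite expr1 scaleN1r tmap0l // add0r linearN tscale_tmapl scale1r; congr (- _).
by rewrite koszul_pr1E; congr (ch_d D n (tscale _)); exact: (@bideg_irr G n.+2 t (1, n.+1)).
Qed.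

Lemma koszul_in0_d n c : ch_d T n (koszul_in0 n.+1 c) = koszul_in0 n (ch_d D n c).
Proof.
have e0 : koszul_pr0 n (ch_d T n (koszul_in0 n.+1 c)) =
    koszul_pr0 n (koszul_in0 n (ch_d D n c)).
  by rewrite koszul_pr0_d !koszul_pr0_in0 koszul_pr1_in0 scaler0 addr0.
case: n c e0 => [|n] c e0; first exact: koszul_ext0.
by apply: koszul_extS => //; rewrite koszul_pr1_d !koszul_pr1_in0 raddf0 oppr0.
Qed.

Lemma koszul_in1_d0 c : ch_d T 0 (koszul_in1 0 c) = x *: koszul_in0 0 c.
Proof.
apply: koszul_ext0; rewrite koszul_pr0_d koszul_pr0_in1 koszul_pr1_in1 raddf0 add0r.
by rewrite linearZ_LR koszul_pr0_in0.
Qed.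

Lemma koszul_in1_dS n c :
  ch_d T n.+1 (koszul_in1 n.+1 c) = x *: koszul_in0 n.+1 c - koszul_in1 n (ch_d D n c).
Proof.
apply: koszul_extS; rewrite ?koszul_pr0_d ?koszul_pr1_d linearB linearZ_LR.
  by rewrite koszul_pr0_in1 !koszul_pr1_in1 koszul_pr0_in0 koszul_pr0_in1 raddf0 add0r subr0.
by rewrite koszul_pr1_in1 koszul_pr1_in0 koszul_pr1_in1 scaler0 add0r.
Qed.
End KoszulCone.

Section KoszulConeMap.
Variables (R : comPzRingType) (x : R) (n m : nat) (le_nm : (n <= m)%N).
Variables (D' D : chain_complex R) (phi : chain_map D' D).
Local Notation F := (ctens_map (koszul1_map x le_nm) phi).

(** The factor x^(m-n) appears in column 1 only; it is what turns the dual
    system into the direct system whose limit is a localization. *)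
Lemma koszul_pr0_map i t : koszul_pr0 _ _ i (F i t) = phi i (koszul_pr0 _ _ i t).
Proof. by rewrite koszul_pr0E [LHS]tscale_tmapl [_ 1]/= scale1r. Qed.
Lemma koszul_pr1_map i t :
  koszul_pr1 _ _ i (F i.+1 t) = x ^+ (m - n) *: phi i (koszul_pr1 _ _ i t).
Proof. by rewrite koszul_pr1E [LHS]tscale_tmapl; congr (_ *: _); exact: mulr1. Qed.

Lemma map_koszul_in0 i c : F i (koszul_in0 _ _ i c) = koszul_in0 _ _ i (phi i c).
Proof.
have e0 : koszul_pr0 _ _ i (F i (koszul_in0 _ _ i c)) =
    koszul_pr0 _ _ i (koszul_in0 (x ^+ n) _ i (phi i c)).
  by rewrite koszul_pr0_map !koszul_pr0_in0.
case: i c e0 => [|i] c e0; first exact: koszul_ext0.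
by apply: koszul_extS => //; rewrite koszul_pr1_map !koszul_pr1_in0 raddf0 scaler0.
Qed.
Lemma map_koszul_in1 i c :
  F i.+1 (koszul_in1 _ _ i c) = x ^+ (m - n) *: koszul_in1 _ _ i (phi i c).
Proof.
apply: koszul_extS; rewrite ?koszul_pr0_map ?koszul_pr1_map linearZ_LR.
  by rewrite !koszul_pr0_in1 raddf0 scaler0.
by rewrite !koszul_pr1_in1.
Qed.
End KoszulConeMap.

(** * Tensor products with a localization *)

(* Fractions a / x ^ n in R_x, as opposed to elements of a fraction field. *)
Local Notation frac := Defs.frac.

Section LocTensor.
Variables (R : comPzRingType) (x : R) (C : lmodType R).

Lemma fracD a n b m :
  frac x a n + frac x b m = frac x (x ^+ m * a + x ^+ n * b) (n + m).
Proof. exact: loc_addE. Qed.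
Lemma fracZ c a n : c *: frac x a n = frac x (c * a) n.
Proof. exact: loc_scaleE. Qed.
Lemma frac_expand n k : frac x 1 n = frac x (x ^+ k) (n + k).
Proof. by apply/frac_eq; exists 0%N; rewrite expr0 !mul1r mulr1 exprD. Qed.
Lemma tens_frac_expand n k c :
  tens (frac x 1 n) c = tens (frac x 1 (n + k)) (x ^+ k *: c) :> tensor (loc x) C.
Proof.
by rewrite tensZr -tensZl fracZ mulr1 -frac_expand.
Qed.

(** Common denominators: the sum of (1 / x^n) (x) c and (1 / x^m) (x) d is a
    pure tensor with denominator x^(n+m). *)
Lemma loc_tensor_surj (q : tensor (loc x) C) :
  exists n c, q = tens (frac x 1 n) c.
Proof.
elim/tensor_ind: q => [|p c t [m [d ->]]]; first by exists 0%N, 0; rewrite tens0r.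
have [a [n ->]] := frac_surj p.
exists (n + m)%N, (x ^+ m *: (a *: c) + x ^+ n *: d).
rewrite tensDr -tens_frac_expand addnC -tens_frac_expand; congr (_ + _).
by rewrite tensZr -tensZl fracZ mulr1.
Qed.

Local Notation sequences := (dprod (fun _ : nat => C)).

(** The direct limit of C -> C -> ... under multiplication by x embeds into the
    sequences in C modulo those that are eventually zero: an element c of the
    n-th copy goes to the sequence of its images x^(k-n) c in the later copies.
    This is a target in which nonzero tensors can be detected, and it avoids
    constructing a localized module. *)
Definition eventually_zero (f : sequences) : Prop :=
  exists N, forall k, (N <= k)%N -> f k = 0.
Lemma eventually_zero0 : eventually_zero 0.
Proof. by exists 0%N. Qed.
Lemma eventually_zeroP a f g :
  eventually_zero f -> eventually_zero g -> eventually_zero (a *: f + g).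
Proof.
move=> [N fN] [N' gN]; exists (N + N')%N => k Nk.
rewrite -[LHS]/(a *: f k + g k) fN ?gN ?scaler0 ?addr0 //.
  exact: leq_trans (leq_addl _ _) Nk.
exact: leq_trans (leq_addr _ _) Nk.
Qed.
Definition germs := quotmod (Submodule eventually_zero0 eventually_zeroP).
HB.instance Definition _ := GRing.Lmodule.on germs.

Definition orbit_germ (p : loc x) (c : C) : germs :=
  qpi _ ((fun k => (x ^+ (k - (repr p).2) * (repr p).1) *: c) : sequences).

(** Two representatives a / x^n and a' / x^n' become equal after
    multiplication by some x^k, so the sequences agree from n + n' + k on. *)
Lemma orbit_germE a n c : orbit_germ (frac x a n) c =
  qpi _ ((fun k => (x ^+ (k - n) * a) *: c) : sequences).
Proof.
rewrite /orbit_germ; case Ep: (repr (frac x a n)) => [a' n'] /=.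
have /frac_eq[k e] : frac x a' n' = frac x a n by rewrite /frac -Ep reprK.
apply/qpi_eq; exists (n + n' + k)%N => j le_j.
apply/eqP; rewrite [_ == _](subr_eq0 (_ *: c)); apply/eqP; congr (_ *: _).
have [i ->] : exists i, j = (n + n' + k + i)%N.
  by exists (j - (n + n' + k))%N; rewrite subnKC.
have -> : (n + n' + k + i - n' = i + k + n)%N by lia.
have -> : (n + n' + k + i - n = i + k + n')%N by lia.
by rewrite !exprD -!mulrA e.
Qed.

Lemma orbit_germ_linearl c : linear (orbit_germ^~ c).
Proof.
move=> s p q; have [a [n ->]] := frac_surj p; have [b [m ->]] := frac_surj q.
rewrite fracZ fracD !orbit_germE -linearP; apply/qpi_eq; exists (n + m)%N => k le_k.
apply/eqP; rewrite [_ == _](subr_eq0 (_ *: c)); apply/eqP.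
rewrite -[RHS]/(s *: ((x ^+ (k - n) * a) *: c) + (x ^+ (k - m) * b) *: c).
rewrite scalerA -scalerDl; congr (_ *: _).
rewrite -{2 3}(subnK le_k) addnA addnK addnAC addnK !exprD; ring.
Qed.

Lemma orbit_germ_linearr p : linear (orbit_germ p).
Proof.
move=> s c d; have [a [n ->]] := frac_surj p.
rewrite !orbit_germE -linearP; congr qpi; apply: functional_extensionality_dep => k.
by rewrite -[RHS]/(s *: (_ *: c) + _ *: d) scalerDr !scalerA mulrC.
Qed.

(** A term x^(N-n) c of the sequence attached to (1 / x^n) (x) c vanishes as
    soon as the sequence is eventually zero. *)
Lemma loc_tensor_eq0 n c : tens (frac x 1 n) c = 0 :> tensor (loc x) C ->
  exists k, x ^+ k *: c = 0.
Proof.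
move=> /(congr1 (tlift orbit_germ_linearl orbit_germ_linearr)).
rewrite tliftE raddf0 orbit_germE -(raddf0 (qpi _)) => /qpi_eq[N /(_ N (leqnn N))].
rewrite subr0 => e; exists (N - n)%N.
by rewrite -[x ^+ _]mulr1.
Qed.
End LocTensor.

(** * The Cech complex as a mapping cone *)
Section CechCone.
Variables (R : comPzRingType) (x : R) (C : cochain_complex R).
Local Notation T := (cotens (cech1 x) C).
Local Notation G := (fun i j => tensor (cech1 x i) (C j) : lmodType R).

Lemma cech1_vanish i j (y : G i.+2 j) : y = 0.
Proof. exact: tensor_zeromod. Qed.

(** In degree n + 1 the complex T is C_{n+1} (+) (R_x (x) C_n), and it is C_0 in
    degree 0; projections and inclusions as for the Koszul complex. *)
Definition cech_pr0 n : {linear T n -> C n} :=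
  @lcomp _ (T n) _ _ (@tscale R (C n)) (@column_prL R G n (bideg0 n)).
Definition cech_pr1 n : {linear T n.+1 -> tensor (loc x) (C n)} :=
  @column_prL R G n.+1 (bideg1 n).
Definition cech_in0 n : {linear C n -> T n} :=
  @lcomp _ _ _ (T n) (@column_inL R G n (bideg0 n)) (@unitens R (C n)).
Definition cech_in1 n : {linear tensor (loc x) (C n) -> T n.+1} :=
  @column_inL R G n.+1 (bideg1 n).

Lemma cech_pr0E n t : cech_pr0 n t = tscale (t (bideg0 n)).
Proof. by []. Qed.
Lemma cech_pr1E n t : cech_pr1 n t = t (bideg1 n).
Proof. by []. Qed.
Lemma cech_in0E n c q :
  cech_in0 n c q = @column_in R G n (bideg0 n) (unitens c) q.
Proof. by []. Qed.
Lemma cech_in1E n c q : cech_in1 n c q = @column_in R G n.+1 (bideg1 n) c q.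
Proof. by []. Qed.

Lemma cech_pr0_in0 n c : cech_pr0 n (cech_in0 n c) = c.
Proof. by rewrite cech_pr0E cech_in0E column_in_same tscale_unitens. Qed.
Lemma cech_pr1_in1 n c : cech_pr1 n (cech_in1 n c) = c.
Proof. by rewrite cech_pr1E cech_in1E column_in_same. Qed.
Lemma cech_pr0_in1 n c : cech_pr0 n.+1 (cech_in1 n c) = 0.
Proof. by rewrite cech_pr0E cech_in1E column_in_other // raddf0. Qed.
Lemma cech_pr1_in0 n c : cech_pr1 n (cech_in0 n.+1 c) = 0.
Proof. by rewrite cech_pr1E cech_in0E column_in_other. Qed.

Lemma cech_ext0 (s t : T 0) : cech_pr0 0 s = cech_pr0 0 t -> s = t.
Proof. by move=> /tscale_inj; apply: (@total_ext0 R G). Qed.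
Lemma cech_extS n (s t : T n.+1) :
  cech_pr0 n.+1 s = cech_pr0 n.+1 t -> cech_pr1 n s = cech_pr1 n t -> s = t.
Proof.
by move=> /tscale_inj s0; apply: (@total_extS R G cech1_vanish).
Qed.

Lemma cech_pr0_d n t : cech_pr0 n.+1 (co_d T n t) = co_d C n (cech_pr0 n t).
Proof.
(* The proofs carried by the bidegrees q and q' here and below are those that
   the unfolded differential produces; [bideg_irr] then replaces them. *)
pose q := exist (bideg_pred n) (0, n) (@bideg_predSr n 0 n (eqxx n.+1)).
rewrite -[LHS]/(tscale (0 + (-1) ^+ 0 *: tmap idfun (co_d C n) (t q))).
rewrite add0r expr0 scale1r tscale_tmapl scale1r cech_pr0E.
congr (co_d C n (tscale _)); exact: (@bideg_irr G n t (0, n)).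
Qed.

Lemma tmap_loc_map (V : lmodType R) u :
  tmap (@loc_map R x) (idfun : {linear V -> V}) u = tens (frac x 1 0) (tscale u).
Proof.
elim/tensor_ind: u => [|a v u IH]; first by rewrite !raddf0 tens0r.
rewrite !linearD tensDr IH tmapE tscaleE tensZr -tensZl fracZ mulr1; congr (_ + _).
Qed.

Lemma cech_pr1_d0 t : cech_pr1 0 (co_d T 0 t) = tens (frac x 1 0) (cech_pr0 0 t).
Proof.
pose q := exist (bideg_pred 0) (0, 0)%N (eqxx 1%N : bideg_pred 0 (0, 0)%N).
rewrite -[LHS]/(tmap (@loc_map R x) idfun (t q) + 0).
rewrite addr0 tmap_loc_map cech_pr0E; congr (tens _ (tscale _)).
exact: (@bideg_irr G 0 t (0, 0)%N).
Qed.

Lemma cech_pr1_dS n t : cech_pr1 n.+1 (co_d T n.+1 t) =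
  tens (frac x 1 0) (cech_pr0 n.+1 t) - tmap idfun (co_d C n) (cech_pr1 n t).
Proof.
pose q := exist (bideg_pred n.+1) (0, n.+1) (eqxx n.+2 : bideg_pred n.+1 (0, n.+1)).
pose q' := exist (bideg_pred n.+1) (1, n) (@bideg_predSr n.+1 1 n (eqxx n.+2)).
rewrite -[LHS]/(tmap (@loc_map R x) idfun (t q) +
  (-1) ^+ 1 *: tmap idfun (co_d C n) (t q')).
rewrite expr1 scaleN1r tmap_loc_map cech_pr0E cech_pr1E.
have -> : t q = t (bideg0 n.+1) by exact: (@bideg_irr G n.+1 t (0, n.+1)).
have -> // : t q' = t (bideg1 n) by exact: (@bideg_irr G n.+1 t (1, n)).
Qed.

End CechCone.

(** * The Cech complex as a direct limit of dual Koszul complexes *)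
Section Presentation.
Variables (R : comPzRingType) (E : lmodType R).
Variables (K : nat -> chain_complex R).
Variable phi : forall n m, (n <= m)%N -> chain_map (K m) (K n).
Variable C : cochain_complex R.

(** An elementwise form of: C is the direct limit of the cochain complexes
    Hom(K_n, E) along the maps dual to phi. In [cp_ker] the homomorphism is
    required to vanish at all large stages rather than at one of them: the
    conditions coming from the two columns of a cone can then be met at a
    common stage without composing transition maps. *)
Record colim_presentation := ColimPresentation {
  cp_map :> forall n i, {linear homod (K n i) E -> C i};
  cp_d : forall n i g, co_d C i (cp_map n i g) = cp_map n i.+1 (hpre (ch_d (K n) i) g);
  cp_phi : forall n m (le_nm : (n <= m)%N) i g,
    cp_map m i (hpre (phi le_nm i) g) = cp_map n i g;
  cp_surj : forall i c, exists n g, c = cp_map n i g;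
  cp_ker : forall n i g, cp_map n i g = 0 ->
    exists m0, forall m (le_nm : (n <= m)%N), (m0 <= m)%N -> hpre (phi le_nm i) g = 0
}.

Lemma cp_rise (P : colim_presentation) i n g m :
  (n <= m)%N -> exists h, P n i g = P m i h.
Proof. by move=> le_nm; exists (hpre (phi le_nm i) g); rewrite cp_phi. Qed.
End Presentation.

Section PresentationCone.
Variables (R : comPzRingType) (E : lmodType R).
Variables (K : nat -> chain_complex R).
Variable phi : forall n m, (n <= m)%N -> chain_map (K m) (K n).
Variable C : cochain_complex R.
Variable P : colim_presentation E phi C.
Variable x : R.

Local Notation T n := (ctens (koszul1 (x ^+ n)) (K n)).
Local Notation T' := (cotens (cech1 x) C).
Local Notation psi le := (ctens_map (koszul1_map x le) (phi le)).
Local Notation in0 n i := (koszul_in0 (x ^+ n) (K n) i).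
Local Notation in1 n i := (koszul_in1 (x ^+ n) (K n) i).

(** A homomorphism T_n -> E is a pair of homomorphisms on the two columns of
    T_n. The one on column 1, of stage n, goes to the fraction with denominator
    x^n, in accordance with the factor x^(m-n) of the transition maps. *)
Definition cone_fun n i : homod (T n i) E -> T' i :=
  match i with
  | 0 => fun g => cech_in0 x C 0 (P n 0 (hpre (in0 n 0) g))
  | i'.+1 => fun g => cech_in0 x C i'.+1 (P n i'.+1 (hpre (in0 n i'.+1) g)) +
      cech_in1 x C i' (tens (frac x 1 n) (P n i' (hpre (in1 n i') g)))
  end.

Lemma cech_pr0_cone n i g : cech_pr0 x C i (@cone_fun n i g) = P n i (hpre (in0 n i) g).
Proof.
case: i g => [|i] g; first exact: cech_pr0_in0.
by rewrite /cone_fun linearD cech_pr0_in0 cech_pr0_in1 addr0.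
Qed.
Lemma cech_pr1_cone n i g : cech_pr1 x C i (@cone_fun n i.+1 g) =
  tens (frac x 1 n) (P n i (hpre (in1 n i) g)).
Proof. by rewrite /cone_fun linearD cech_pr1_in0 cech_pr1_in1 add0r. Qed.

Lemma cone_linear n i : linear (@cone_fun n i).
Proof.
move=> a g h.
have e0 : cech_pr0 x C i (cone_fun (a *: g + h)) =
    cech_pr0 x C i (a *: cone_fun g + cone_fun h).
  by rewrite [RHS]linearP !cech_pr0_cone !linearP.
case: i g h e0 => [|i] g h e0; first exact: cech_ext0.
apply: cech_extS => //.
by rewrite [RHS]linearP !cech_pr1_cone !linearP -tensZr -tensDr.
Qed.
HB.instance Definition _ n i :=
  GRing.isLinear.Build R (homod (T n i) E) (T' i) *:%R (@cone_fun n i) (@cone_linear n i).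
Definition cone_map n i : {linear homod (T n i) E -> T' i} := @cone_fun n i.

Lemma tmap_tens_frac n i c : tmap idfun (co_d C i) (tens (frac x 1 n) c) =
  tens (frac x 1 n) (co_d C i c).
Proof. exact: tmapE. Qed.

(** In column 1 the differential of T_n contributes x^n times the restriction of
    g to column 0, and (1 / x^n) (x) x^n c = 1 (x) c is the localization map. *)
Lemma cone_d n i g :
  co_d T' i (cone_map n i g) = cone_map n i.+1 (hpre (ch_d (T n) i) g).
Proof.
have e0 : cech_pr0 x C i.+1 (co_d T' i (cone_map n i g)) =
    cech_pr0 x C i.+1 (cone_map n i.+1 (hpre (ch_d (T n) i) g)).
  rewrite cech_pr0_d !cech_pr0_cone cp_d; congr (P n i.+1 _).
  by apply: homod_ext => z; rewrite !hpreE koszul_in0_d.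
have expand c : tens (frac x 1 n) (x ^+ n *: c) =
    tens (frac x 1 0) c :> tensor (loc x) (C i).
  by rewrite [RHS](tens_frac_expand x 0 n) add0n.
apply: cech_extS => //; case: i g e0 expand => [|i] g _ expand.
  rewrite cech_pr1_d0 cech_pr0_cone cech_pr1_cone -expand -linearZ_LR.
  congr (tens _ (P n 0 _)).
  by apply: homod_ext => z; rewrite !hpreE koszul_in1_d0 linearZ_LR.
rewrite cech_pr1_dS cech_pr0_cone !cech_pr1_cone tmap_tens_frac cp_d -expand.
rewrite -[- tens _ _]scaleN1r -tensZr -tensDr scaleN1r -linearZ_LR -linearB.
congr (tens _ (P n i.+1 _)).
by apply: homod_ext => z; rewrite !hpreE koszul_in1_dS linearB linearZ_LR.
Qed.

Lemma cone_phi n m (le_nm : (n <= m)%N) i g :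
  cone_map m i (hpre (psi le_nm i) g) = cone_map n i g.
Proof.
have e0 : cech_pr0 x C i (cone_map m i (hpre (psi le_nm i) g)) =
    cech_pr0 x C i (cone_map n i g).
  rewrite !cech_pr0_cone -[RHS](cp_phi P le_nm); congr (P m i _).
  by apply: homod_ext => z; rewrite !hpreE map_koszul_in0.
case: i g e0 => [|i] g e0; first exact: cech_ext0.
apply: cech_extS => //.
rewrite !cech_pr1_cone -[in RHS](cp_phi P le_nm).
rewrite [RHS](tens_frac_expand x n (m - n)) subnKC // -linearZ_LR.
congr (tens _ (P m i _)).
by apply: homod_ext => z; rewrite !hpreE map_koszul_in1 linearZ_LR.
Qed.

(** The stages of the two components and the denominator are raised to a common
    stage m. *)
Lemma cone_surj i c : exists n g, c = cone_map n i g.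
Proof.
case: i c => [|i] c.
  have [n [g gP]] := cp_surj P (cech_pr0 x C 0 c).
  exists n, (hpre (koszul_pr0 (x ^+ n) (K n) 0) g); apply: cech_ext0.
  rewrite cech_pr0_cone gP; congr (P n 0 _).
  by apply: homod_ext => z; rewrite !hpreE koszul_pr0_in0.
have [n0 [g0 g0P]] := cp_surj P (cech_pr0 x C i.+1 c).
have [p [c' c'P]] := loc_tensor_surj (cech_pr1 x C i c).
have [n1 [g1 g1P]] := cp_surj P c'.
pose m := (n0 + (n1 + p))%N.
have [h0 h0P] := @cp_rise _ _ _ _ _ P i.+1 n0 g0 m (leq_addr _ _).
have [h1 h1P] := @cp_rise _ _ _ _ _ P i n1 g1 m
  (leq_trans (leq_addr _ _) (leq_addl _ _)).
have le_pm : (p <= m)%N by rewrite /m addnA leq_addl.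
exists m, (hpre (koszul_pr0 (x ^+ m) (K m) i.+1) h0 +
  hpre (koszul_pr1 (x ^+ m) (K m) i) (x ^+ (m - p) *: h1)).
apply: cech_extS; rewrite ?cech_pr0_cone ?cech_pr1_cone.
  rewrite g0P h0P; congr (P m i.+1 _); apply: homod_ext => z.
  by rewrite hpreE -[RHS]/(happ h0 (koszul_pr0 _ _ _ (in0 m i.+1 z)) +
    _ *: happ h1 (koszul_pr1 _ _ _ (in0 m i.+1 z)))
    koszul_pr0_in0 koszul_pr1_in0 raddf0 scaler0 addr0.
rewrite c'P (tens_frac_expand x p (m - p)) subnKC // g1P h1P -linearZ_LR.
congr (tens _ (P m i _)); apply: homod_ext => z.
by rewrite hpreE -[RHS]/(happ h0 (koszul_pr0 _ _ _ (in1 m i z)) +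
  _ *: happ h1 (koszul_pr1 _ _ _ (in1 m i z)))
  koszul_pr0_in1 koszul_pr1_in1 raddf0 add0r.
Qed.

(** If the component in R_x (x) C is zero, then x^k kills the component of g on
    column 1 for some k, up to a later stage. From stage n + k on the factor
    x^(m-n) is a multiple of x^k, so column 1 dies as well. *)
Lemma cone_ker n i g : cone_map n i g = 0 ->
  exists m0, forall m (le_nm : (n <= m)%N), (m0 <= m)%N -> hpre (psi le_nm i) g = 0.
Proof.
move=> g0.
have := congr1 (cech_pr0 x C i) g0; rewrite cech_pr0_cone raddf0 => /cp_ker[m0 m0P].
have phi_in0 m (le_nm : (n <= m)%N) c : (m0 <= m)%N ->
    happ g (psi le_nm i (in0 m i c)) = 0.
  move=> le_m; rewrite map_koszul_in0.
  by have := congr1 (fun h => happ h c) (m0P m le_nm le_m).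
case: i g g0 m0P phi_in0 => [|i] g g0 m0P phi_in0.
  exists m0 => m le_nm le_m; apply: homod_ext => z.
  by rewrite hpreE (koszul_split0 z) phi_in0.
have := congr1 (cech_pr1 x C i) g0; rewrite cech_pr1_cone raddf0 => /loc_tensor_eq0[k].
rewrite -linearZ_LR => /cp_ker[m1 m1P].
exists (m0 + m1 + (n + k))%N => m le_nm le_m; apply: homod_ext => z.
rewrite hpreE -[RHS]/(0 : E) (koszul_splitS z).
rewrite happ_mapD phi_in0 ?add0r; last by lia.
rewrite map_koszul_in1 happZ.
have le_m1 : (m1 <= m)%N by lia.
have -> : (m - n = (m - n - k) + k)%N by lia.
rewrite exprD -scalerA.
have := congr1 (fun h => happ h (koszul_pr1 _ _ _ z)) (m1P m le_nm le_m1).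
rewrite -[happ _ _]/(x ^+ k *: happ g (in1 n i (phi le_nm i (koszul_pr1 _ _ _ z)))) => ->.
exact: scaler0.
Qed.

Definition cone_presentation : colim_presentation E (fun n m le => psi le) T' :=
  ColimPresentation cone_d cone_phi cone_surj cone_ker.
End PresentationCone.

Section CechPresentation.
Variables (R : comPzRingType) (M E : lmodType R).

Definition base_map n i :
    homod (koszul (powers [::] n) M i) E -> cech [::] (homod M E) i :=
  match i with 0 => idfun | _ => fun _ => 0 end.
Lemma base_linear n i : linear (@base_map n i).
Proof. by case: i => [|i] a g h //=; rewrite scaler0 addr0. Qed.
HB.instance Definition _ n i := GRing.isLinear.Build R
  (homod (koszul (powers [::] n) M i) E) (cech [::] (homod M E) i) *:%R
  (@base_map n i) (@base_linear n i).

Lemma hom_zeromod (g : homod (zeromod R) E) : g = 0.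
Proof. by apply: homod_ext => z; rewrite [z]thinmx0 raddf0. Qed.

Lemma zeromod_eq0 (z : zeromod R) : z = 0.
Proof. exact: thinmx0. Qed.

Definition base_presentation :
  colim_presentation E (fun n m le => @koszul_map R n m le [::] M) (cech [::] (homod M E)).
Proof.
refine (@ColimPresentation R E (fun n => koszul (powers [::] n) M) _ _
  (fun n i => @base_map n i) _ _ _ _).
- by move=> n i g; rewrite [RHS]zeromod_eq0; apply: zeromod_eq0.
- by move=> n m le [|i] g //=; apply: homod_ext.
- by case=> [|i] c; [exists 0%N, c | exists 0%N, 0; apply: zeromod_eq0].
- move=> n [|i] g.
    move=> g0; exists 0%N => m le _; have -> : g = 0 by [].
    exact: raddf0.
  by move=> _; exists 0%N => m le _; rewrite [g]hom_zeromod raddf0.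
Defined.

Fixpoint cech_presentation xs :
  colim_presentation E (fun n m le => @koszul_map R n m le xs M) (cech xs (homod M E)) :=
  match xs with
  | [::] => base_presentation
  | x :: xs' => cone_presentation (cech_presentation xs') x
  end.
End CechPresentation.

(** * Extension of additive maps into divisible groups *)
Section PartialAdditive.
Variables B D : zmodType.

(** An additive map defined on a subgroup of B, given by its graph: extension is
    inclusion of graphs, and the union of a chain is again one. *)
Record partial_additive := PartialAdditive {
  pgraph :> B -> D -> Prop;
  pgraph0 : pgraph 0 0;
  pgraphB : forall x y x' y', pgraph x y -> pgraph x' y' -> pgraph (x - x') (y - y');
  pgraph_fun : forall y, pgraph 0 y -> y = 0
}.
Implicit Type G : partial_additive.

Lemma pgraphN G x y : G x y -> G (- x) (- y).
Proof.
by move=> xy; rewrite -[- x]sub0r -[- y]sub0r; apply: pgraphB => //; apply: pgraph0.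
Qed.
Lemma pgraphD G x y x' y' : G x y -> G x' y' -> G (x + x') (y + y').
Proof. by move=> xy /pgraphN; rewrite -{2}[x']opprK -{2}[y']opprK; apply: pgraphB. Qed.
Lemma pgraphMz G x y (k : int) : G x y -> G (x *~ k) (y *~ k).
Proof.
move=> xy; have xyn n : G (x *+ n) (y *+ n).
  elim: n => [|n IH]; first by rewrite !mulr0n; apply: pgraph0.
  by rewrite !mulrS; apply: pgraphD.
by case: k => n; rewrite ?NegzE ?mulrNz; [apply: xyn | apply/pgraphN/xyn].
Qed.
Lemma pgraph_inj G x y y' : G x y -> G x y' -> y = y'.
Proof.
move=> xy xy'; apply/eqP; rewrite -subr_eq0; apply/eqP/(@pgraph_fun G).
by rewrite -(subrr x); apply: pgraphB.
Qed.

(** The condition under which b can be sent to d consistently with G. *)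
Definition compatible G b d := forall (k : int) e, G (b *~ k) e -> e = d *~ k.

(** The integers k such that k b lies in the domain of G form a subgroup of Z.
    It is zero, and then there is no constraint on d, or it is generated by its
    least positive element n, and then n d = G(n b) is the only constraint. *)
Lemma compatible_cases G b : (forall d, compatible G b d) \/
  exists n e, [/\ (0 < n)%N, G (b *+ n) e & forall d, d *+ n = e -> compatible G b d].
Proof.
have [bG|bG] := pselect (exists n, (0 < n)%N && `[< exists e, G (b *+ n) e >]).
  right; case: (ex_minnP bG) => n /andP[n0 /asboolP[e be] n_min].
  exists n, e; split=> // d dn k e' be'.
  have n_neq0 : n%:Z != 0 by case: (n) n0.
  have [q [r [kE r0 rn]]] : exists q r : int, [/\ k = q * n%:Z + r, 0 <= r & r < n%:Z].
    exists (k %/ n)%Z, (k %% n)%Z; split; first exact: divz_eq.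
      exact: modz_ge0.
    exact: ltz_pmod.
  have br : G (b *~ r) (e' - e *~ q).
    have -> : b *~ r = b *~ k - (b *+ n) *~ q.
      by rewrite kE mulrzDr pmulrn -mulrzA [n%:Z * q]mulrC addrAC subrr add0r.
    by apply: pgraphB => //; apply: pgraphMz.
  have r_eq0 : r = 0.
    case: r r0 rn br {kE} => // -[|r] // _ rn br.
    have : (n <= r.+1)%N.
      by apply: n_min; apply/asboolP; exists (e' - e *~ q).
    by rewrite leqNgt -ltz_nat rn.
  move: br; rewrite r_eq0 mulr0z => /pgraph_fun/eqP; rewrite subr_eq0 => /eqP ->.
  by rewrite kE r_eq0 addr0 -dn pmulrn -mulrzA mulrC.
left=> d k e be; have k0 : k = 0.
  apply: contrapT => k0; apply: bG; exists `|k|%N; rewrite absz_gt0.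
  apply/andP; split; first exact/eqP.
  apply/asboolP; case: k k0 be => k k0 be; first by exists e.
  by exists (- e); move/pgraphN: be; rewrite NegzE mulrNz opprK.
by move: be; rewrite k0 !mulr0z => /pgraph_fun.
Qed.

Section Adjoin.
Variables (G : partial_additive) (b : B) (d : D).
Hypothesis bd : compatible G b d.

Definition adjoin_graph x y :=
  exists x' y' (k : int), [/\ G x' y', x = x' + b *~ k & y = y' + d *~ k].

Lemma adjoin0 : adjoin_graph 0 0.
Proof. by exists 0, 0, 0; rewrite !mulr0z !addr0; split=> //; apply: pgraph0. Qed.
Lemma adjoinB x y x' y' :
  adjoin_graph x y -> adjoin_graph x' y' -> adjoin_graph (x - x') (y - y').
Proof.
move=> [u [v [k [uv -> ->]]]] [u' [v' [k' [uv' -> ->]]]].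
exists (u - u'), (v - v'), (k - k'); split; first exact: pgraphB.
  by rewrite mulrzBr opprD addrACA.
by rewrite mulrzBr opprD addrACA.
Qed.
Lemma adjoin_fun y : adjoin_graph 0 y -> y = 0.
Proof.
move=> [u [v [k [uv /esym/eqP]]]]; rewrite addr_eq0 -mulrNz => /eqP uE ->.
by move: uv; rewrite uE => /bd ->; rewrite mulrNz addNr.
Qed.
Definition adjoin := PartialAdditive adjoin0 adjoinB adjoin_fun.

Lemma adjoin_sub x y : G x y -> adjoin x y.
Proof. by move=> xy; exists x, y, 0; rewrite !mulr0z !addr0. Qed.
Lemma adjoin_new : adjoin b d.
Proof. by exists 0, 0, 1; rewrite !mulr1z !add0r; split=> //; apply: pgraph0. Qed.
End Adjoin.

Definition divisible := forall n d, (0 < n)%N -> exists d', d' *+ n = d :> D.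
Hypothesis divD : divisible.

Lemma compatible_exists G b : exists d, compatible G b d.
Proof.
have [cG|[n [e [n0 _ cG]]]] := compatible_cases G b; first by exists 0.
by have [d /cG] := divD e n0; exists d.
Qed.

(** Zorn's lemma gives a maximal extension; divisibility allows one more element
    to be adjoined to it, so that it is defined everywhere. *)
Lemma partial_additive_extend G :
  exists f : {additive B -> D}, forall x y, G x y -> f x = y.
Proof.
(* Only the extensions of G are ordered, so that the empty chain is bounded by G. *)
pose above := {H : partial_additive | forall x y, G x y -> H x y}.
pose le (H H' : above) := `[< forall x y, sval H x y -> sval H' x y >].
have [||A totA|H H_max] := @ZL_preorder above (exist _ G (fun _ _ xy => xy)) le.
- by move=> H; apply/asboolP.
- by move=> H1 H2 H3 /asboolP h12 /asboolP h23; apply/asboolP => x y /h12/h23.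
- have [[H0 AH0]|nA] := pselect (exists H, A H); last first.
    by exists (exist _ G (fun _ _ xy => xy)) => H AH; case: nA; exists H.
  pose U x y := exists2 H, A H & sval H x y.
  have U0 : U 0 0 by exists H0 => //; apply: pgraph0.
  have UB x y x' y' : U x y -> U x' y' -> U (x - x') (y - y').
    move=> [H AH xy] [H' AH' xy'].
    have [/asboolP HH'|/asboolP HH'] := totA _ _ AH AH'.
      by exists H' => //; apply: pgraphB => //; apply: HH'.
    by exists H => //; apply: pgraphB => //; apply: HH'.
  have Uf y : U 0 y -> y = 0 by move=> [H _ /pgraph_fun].
  have GU x y : G x y -> U x y by move=> xy; exists H0 => //; apply: (svalP H0).
  exists (exist _ (PartialAdditive U0 UB Uf) GU) => H AH.
  by apply/asboolP => x y xy; exists H.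
have H_total x : exists y, sval H x y.
  have [d cd] := compatible_exists (sval H) x.
  have GH u v : G u v -> adjoin cd u v by move=> uv; apply/adjoin_sub/(svalP H).
  exists d.
  have /asboolP := H_max (exist _ (adjoin cd) GH) (asboolT (@adjoin_sub _ _ _ cd)).
  by apply; apply: adjoin_new.
pose f x := sval (cid (H_total x)); have fP x : sval H x (f x) by apply: svalP.
have f_add : zmod_morphism f.
  by move=> x y; apply: (@pgraph_inj (sval H) (x - y)) => //; apply: pgraphB.
exists (HB.pack f (GRing.isZmodMorphism.Build B D f f_add) : {additive B -> D}).
move=> x y /(svalP H) xy.
exact: (pgraph_inj (fP x)).
Qed.
End PartialAdditive.

(** * Injective modules *)
Section RationalsModuloIntegers.

Definition is_integer (q : zmodule rat) : Prop := exists k : int, q = k%:~R :> rat.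
Lemma is_integer0 : is_integer 0.
Proof. by exists 0. Qed.
Lemma is_integerP (a : int) x y : is_integer x -> is_integer y -> is_integer (a *: x + y).
Proof.
move=> [k ->] [l ->]; exists (k * a + l).
by rewrite scalezrE rmorphD rmorphM /= mulrzr.
Qed.

Definition QmodZ : lmodType int := quotmod (Submodule is_integer0 is_integerP).
Definition modZ (q : rat) : QmodZ :=
  @qpi int (zmodule rat) (Submodule is_integer0 is_integerP) q.

Lemma modZMn q n : modZ (q *+ n) = modZ q *+ n.
Proof. exact: raddfMn. Qed.

Lemma QmodZ_divisible : divisible QmodZ.
Proof.
move=> n d n0; have [q ->] := qpi_surj d.
exists (modZ (q / n%:R)); rewrite -modZMn -(mulr_natr (q / n%:R)) divfK //.
by rewrite pnatr_eq0 -lt0n.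
Qed.

Lemma modZ_inv_neq0 n : (1 < n)%N -> modZ n%:R^-1 <> 0.
Proof.
move=> n1; rewrite -(raddf0 (qpi _)) => /qpi_eq[k]; rewrite subr0 => nk.
have n_neq0 : n%:R != 0 :> rat by rewrite pnatr_eq0 -lt0n ltnW.
have : (k * n%:Z)%:~R = 1%:~R :> rat by rewrite intrM -nk mulVf.
move/intr_inj/(congr1 absz); rewrite abszM /= => /eqP.
rewrite muln_eq1 => /andP[_ /eqP nE].
by rewrite nE in n1.
Qed.

Definition zero_graph (B D : zmodType) : partial_additive B D.
Proof.
refine (@PartialAdditive B D (fun x y => x = 0 /\ y = 0) _ _ _) => //.
  by move=> x y x' y' [-> ->] [-> ->]; rewrite !subr0.
by move=> y [].
Defined.

(** On the cyclic group generated by b there is a nonzero map to Q/Z: b goes to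
    1 / n if it has order n, and to any nonzero element, here 1 / 2, if it has
    infinite order. It then extends to the whole group. *)
Lemma character_exists (B : zmodType) (b : B) : b <> 0 ->
  exists f : {additive B -> QmodZ}, f b <> 0.
Proof.
move=> b0.
have [d [cd d0]] : exists d : QmodZ, compatible (zero_graph B QmodZ) b d /\ d <> 0.
  have [cG|[n [e [n0 [bn e0] cG]]]] := compatible_cases (zero_graph B QmodZ) b.
    by exists (modZ 2%:R^-1); split; [apply: cG | apply: modZ_inv_neq0].
  have n1 : (1 < n)%N.
    by case: n n0 bn {cG} => // -[|n] // _; rewrite mulr1n => /b0.
  exists (modZ n%:R^-1); split; last exact: modZ_inv_neq0.
  apply: cG; rewrite e0 -modZMn -(mulr_natr n%:R^-1) mulVf ?pnatr_eq0 -?lt0n //.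
  rewrite -(raddf0 (qpi _)); apply/qpi_eq; exists 1; exact: subr0.
have [f fP] := partial_additive_extend QmodZ_divisible (adjoin cd).
by exists f; rewrite (fP _ _ (adjoin_new cd)).
Qed.
End RationalsModuloIntegers.

Section CharacterModule.
Variable R : comPzRingType.

(** Hom_Z(R, Q/Z). Its R-module structure (a u)(r) = u(a r) differs from the
    structure of a homomorphism module over the integers, hence a new name for
    the same underlying group. *)
Definition charmod : Type := homod (zmodule R) QmodZ.
HB.instance Definition _ := GRing.Zmodule.on charmod.

Definition ev (u : charmod) (r : R) : QmodZ := @happ int QmodZ (zmodule R) u r.

Lemma charmod_ext u v : ev u =1 ev v -> u = v.
Proof. exact: (@homod_ext int QmodZ (zmodule R) u v). Qed.
Lemma evD u v r : ev (u + v) r = ev u r + ev v r.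
Proof. by []. Qed.
Lemma evB u v r : ev (u - v) r = ev u r - ev v r.
Proof. by []. Qed.
Lemma ev_additive u r s : ev u (r + s) = ev u r + ev u s.
Proof. exact: (linearD (@happ int QmodZ (zmodule R) u)). Qed.

Lemma additive_int_linear (f : {additive R -> QmodZ}) : linear (f : zmodule R -> QmodZ).
Proof.
move=> a x y; rewrite raddfD; congr (_ + _).
by rewrite scalezrE raddfMz -scaler_int intz.
Qed.
Definition of_additive (f : {additive R -> QmodZ}) : charmod :=
  @hom_of int QmodZ (zmodule R) (HB.pack (f : zmodule R -> QmodZ)
    (GRing.isLinear.Build int (zmodule R) QmodZ *:%R (f : zmodule R -> QmodZ)
       (additive_int_linear f))).
Lemma shift_additive (u : charmod) (a : R) : zmod_morphism (fun r : R => ev u (a * r)).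
Proof.
by move=> x y; rewrite mulrBr; exact: (linearB (@happ int QmodZ (zmodule R) u)).
Qed.
Definition char_scale (a : R) (u : charmod) : charmod :=
  of_additive (HB.pack (fun r : R => ev u (a * r))
    (GRing.isZmodMorphism.Build R QmodZ _ (shift_additive u a)) : {additive R -> QmodZ}).
Lemma ev_scale a u r : ev (char_scale a u) r = ev u (a * r).
Proof. by []. Qed.

Fact char_scaleA a b u : char_scale a (char_scale b u) = char_scale (a * b) u.
Proof. by apply: charmod_ext => r; rewrite !ev_scale mulrCA mulrA. Qed.
Fact char_scale1 : left_id 1 char_scale.
Proof. by move=> u; apply: charmod_ext => r; rewrite ev_scale mul1r. Qed.
Fact char_scaleDr : right_distributive char_scale +%R.
Proof. by move=> a u v; apply: charmod_ext => r; rewrite evD !ev_scale evD. Qed.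
Fact char_scaleDl u : {morph char_scale^~ u : a b / a + b}.
Proof. by move=> a b; apply: charmod_ext => r; rewrite evD !ev_scale mulrDl ev_additive. Qed.
HB.instance Definition _ := GRing.Zmodule_isLmodule.Build R charmod
  char_scaleA char_scale1 char_scaleDr char_scaleDl.
Lemma ev_scaler a (u : charmod) r : ev (a *: u) r = ev u (a * r).
Proof. by []. Qed.

(** Additive maps chi : B -> Q/Z correspond to R-linear maps from B to
    Hom_Z(R, Q/Z): b goes to r |-> chi (r b), and chi is recovered by evaluation
    at 1. *)
Section Coinduce.
Variables (B : lmodType R) (chi : {additive B -> QmodZ}).

Lemma coinduce_additive b : zmod_morphism (fun r : R => chi (r *: b)).
Proof. by move=> r s; rewrite scalerBl raddfB. Qed.
Definition coinduce_fun (b : B) : charmod :=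
  of_additive (HB.pack (fun r : R => chi (r *: b))
    (GRing.isZmodMorphism.Build R QmodZ _ (coinduce_additive b)) : {additive R -> QmodZ}).
Lemma ev_coinduce b r : ev (coinduce_fun b) r = chi (r *: b).
Proof. by []. Qed.
Lemma coinduce_linear : linear coinduce_fun.
Proof.
move=> a b c; apply: charmod_ext => r.
by rewrite evD ev_scaler !ev_coinduce scalerDr raddfD scalerA mulrC.
Qed.
HB.instance Definition _ :=
  GRing.isLinear.Build R B charmod *:%R coinduce_fun coinduce_linear.
Definition coinduce : {linear B -> charmod} := coinduce_fun.
End Coinduce.

(** By this correspondence, extending a linear map to Hom_Z(R, Q/Z) amounts to
    extending an additive map to Q/Z. *)
Lemma charmod_injective : injective_module charmod.
Proof.
move=> A B i f i_inj.
pose G b y := exists a, b = i a /\ y = ev (f a) 1.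
have G0 : G 0 0 by exists 0; rewrite !raddf0.
have GB x y x' y' : G x y -> G x' y' -> G (x - x') (y - y').
  by move=> [a [-> ->]] [a' [-> ->]]; exists (a - a'); rewrite !raddfB evB.
have Gf y : G 0 y -> y = 0.
  by move=> [a [/esym ia ->]]; rewrite (i_inj a 0) ?raddf0.
have [chi chiP] := partial_additive_extend QmodZ_divisible (PartialAdditive G0 GB Gf).
exists (coinduce chi) => a; apply: charmod_ext => r.
rewrite ev_coinduce -linearZ (chiP _ (ev (f (r *: a)) 1)); last by exists (r *: a).
by rewrite linearZ ev_scaler mulr1.
Qed.

Lemma dprod_injective (I : Type) (F : I -> lmodType R) :
  (forall i, injective_module (F i)) -> injective_module (dprod F).
Proof.
move=> F_inj A B i f i_inj.
have f_lin k : linear (fun a => f a k) by move=> c x y; rewrite linearP.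
pose fk k : {linear A -> F k} := 
  HB.pack (fun a => f a k) (GRing.isLinear.Build R A (F k) *:%R _ (f_lin k)).
pose g k := sval (cid (F_inj k A B i (fk k) i_inj)).
have gP k a : g k (i a) = f a k by rewrite (svalP (cid (F_inj k A B i (fk k) i_inj))).
have g_lin : linear ((fun b k => g k b) : B -> dprod F).
  by move=> c x y; apply: functional_extensionality_dep => k; exact: (linearP (g k)).
exists (HB.pack ((fun b k => g k b) : B -> dprod F)
  (GRing.isLinear.Build R B (dprod F) *:%R _ g_lin) : {linear B -> dprod F}).
by move=> a; apply: functional_extensionality_dep => k; exact: gP.
Qed.

(** For each nonzero h some character of H does not vanish at h; the product of
    all these characters, indexed by the elements of H, is injective. *)
Theorem enough_injectives (H : lmodType R) :
  exists2 E : lmodType R, injective_module E &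
    exists j : {linear H -> E}, forall h, j h = 0 -> h = 0.
Proof.
pose F (h : H) : lmodType R := charmod.
exists (dprod F); first by apply: dprod_injective => h; apply: charmod_injective.
have chi_ex (h : H) : exists chi : {additive H -> QmodZ}, h <> 0 -> chi h <> 0.
  have [->|/eqP h0] := eqVneq h 0; first by exists \0.
  by have [chi] := character_exists h0; exists chi.
pose chi h := sval (cid (chi_ex h)).
pose j h' : dprod F := fun h => coinduce (chi h) h'.
have j_lin : linear j.
  move=> c x y; apply: functional_extensionality_dep => h.
  exact: (linearP (coinduce (chi h))).
exists (HB.pack j (GRing.isLinear.Build R H (dprod F) *:%R _ j_lin) :
  {linear H -> dprod F}) => h jh.
apply: contrapT => h0; apply: (svalP (cid (chi_ex h)) h0).
have := congr1 (fun u : dprod F => ev (u h) 1) jh.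
by rewrite -[LHS]/(chi h (1 *: h)) scale1r.
Qed.
End CharacterModule.

(** * Homology and exactness *)
Section Homology.
Variable R : comPzRingType.

Definition cycle_of (C : chain_complex R) n (z : C n) (dz : ch_cycle z) : ch_cycles C n :=
  Submod (asboolT dz : z \in smemb (Submodule (@ch_cycle0 R C n) (@ch_cycleP R C n))).

Definition cocycle_of (C : cochain_complex R) n (c : C n) (dc : co_cycle c) : co_cycles C n :=
  Submod (asboolT dc : c \in smemb (Submodule (@co_cycle0 R C n) (@co_cycleP R C n))).

Lemma homology_map_eq0P (C D : chain_complex R) (f : chain_map C D) n :
  (forall h, homology_map f n h = 0) <->
  (forall z, ch_cycle z -> exists y, f n z = ch_d D n y).
Proof.
split=> [f0 z zc|fb h].
  have := f0 (qpi _ (cycle_of zc)).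
  rewrite /homology_map qlift_pi /= /hmap_cycle -(raddf0 (qpi _)) => /qpi_eq.
  by rewrite subr0.
have [z ->] := qpi_surj h.
rewrite /homology_map qlift_pi /= /hmap_cycle -(raddf0 (qpi _)); apply/qpi_eq.
rewrite subr0; have [y fy] := fb _ (asboolW (submod_valP z)).
by exists y.
Qed.

Lemma cohomology_eq0P (C : cochain_complex R) n :
  (forall h : cohomology C n.+1, h = 0) <->
  (forall c, co_d C n.+1 c = 0 -> exists b, c = co_d C n b).
Proof.
split=> [H0 c dc|H0 h].
  have := H0 (qpi _ (cocycle_of dc)).
  rewrite -(raddf0 (qpi _)) => /qpi_eq; rewrite subr0 => -[b]; by exists b.
have [z ->] := qpi_surj h.
rewrite -(raddf0 (qpi _)); apply/qpi_eq; rewrite subr0.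
have [b cb] := H0 _ (asboolW (submod_valP z)).
by exists b.
Qed.

(** The map induced by d on the quotient of A by its kernel is injective, and g
    descends to this quotient. *)
Lemma factor_through (A B E : lmodType R) (d : {linear A -> B}) (g : homod A E) :
  injective_module E -> (forall a, d a = 0 -> happ g a = 0) ->
  exists h : homod B E, g = hpre d h.
Proof.
move=> E_inj dg.
pose ker a := d a = 0.
have ker0 : ker 0 by exact: raddf0.
have kerP c x y : ker x -> ker y -> ker (c *: x + y).
  by rewrite /ker linearP => -> ->; rewrite scaler0 addr0.
pose W := Submodule ker0 kerP.
have dW a : W a -> d a = 0 by [].
have gW a : W a -> happ g a = 0 by exact: dg.
have d_inj : injective (qlift dW).
  move=> p q; have [a ->] := qpi_surj p; have [b ->] := qpi_surj q.
  rewrite !qlift_pi => dab; apply/qpi_eq; rewrite /= /ker.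
  by rewrite linearB dab subrr.
have [h hP] := E_inj _ _ (qlift dW) (qlift gW) d_inj.
exists (hom_of h); apply: homod_ext => a.
by have := hP (qpi _ a); rewrite !qlift_pi.
Qed.
End Homology.

(** * The inverse system of Koszul complexes *)
Section KoszulTower.
Variables (R : comPzRingType) (M : lmodType R).

Lemma koszul_vanish (xs : seq R) i (z : koszul xs M i) : (size xs < i)%N -> z = 0.
Proof.
elim: xs i z => [|x xs IH] [|i] z //= lt_i; first exact: thinmx0.
have lt_i' : (size xs < i.+1)%N by apply: ltnW.
apply: (@koszul_extS R x (koszul xs M)).
  by rewrite raddf0; apply: IH.
by rewrite raddf0; apply: IH.
Qed.

Lemma koszul_map_comp (xs : seq R) n m p (le_nm : (n <= m)%N) (le_mp : (m <= p)%N)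
    (le_np : (n <= p)%N) i (z : koszul (powers xs p) M i) :
  koszul_map le_nm xs M i (koszul_map le_mp xs M i z) = koszul_map le_np xs M i z.
Proof.
elim: xs i z => [|x xs IH] i z //.
have e0 :
  koszul_pr0 _ _ i (koszul_map le_nm (x :: xs) M i (koszul_map le_mp (x :: xs) M i z)) =
  koszul_pr0 _ _ i (koszul_map le_np (x :: xs) M i z).
  by rewrite !koszul_pr0_map IH.
case: i z e0 => [|i] z e0; first exact: koszul_ext0 e0.
apply: koszul_extS e0 _.
rewrite !koszul_pr1_map linearZ scalerA IH -exprD; congr (_ ^+ _ *: _).
by rewrite addnC addnBA // subnK.
Qed.
End KoszulTower.

(** * Weak proregularity and Cech cohomology *)
Section Equivalence.
Variables (R : comPzRingType) (M : lmodType R) (xs : seq R).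
Local Notation K n := (koszul (powers xs n) M).
Local Notation phi le := (koszul_map le xs M).

(** A cocycle comes from some g on K_n, and after raising n, from a g that
    vanishes on boundaries. At a stage p where the map on homology is zero,
    cycles of K_p become boundaries, so g vanishes on them and factors through
    the differential because E is injective. *)
Lemma cech_exact_of_weakly_proregular (E : lmodType R) i c :
  weakly_proregular xs M -> injective_module E ->
  co_d (cech xs (homod M E)) i.+1 c = 0 -> exists b, c = co_d (cech xs (homod M E)) i b.
Proof.
move=> wpr E_inj; pose P := cech_presentation M E xs.
have [n [g ->]] := cp_surj P c.
rewrite cp_d => /cp_ker[m0 m0P].
pose m := maxn n m0.
have gd := m0P m (leq_maxl _ _) (leq_maxr _ _).
have [p [le_mp /(_ i.+1 isT)/homology_map_eq0P pP]] := wpr m.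
have [z dz|h hP] := factor_through (d := ch_d (K p) i)
    (g := hpre (phi le_mp i.+1) (hpre (phi (leq_maxl n m0) i.+1) g)) E_inj.
  rewrite !hpreE; have [y ->] := pP z dz.
  by have := congr1 (fun u => happ u y) gd; rewrite !hpreE cm_d.
exists (P p i h); rewrite cp_d -hP !cp_phi //.
Qed.

(** The embedding of H_{i+1}(K_n) into E extends to some g on K_n, which is
    a cocycle. Exactness makes g a coboundary in the limit, hence a coboundary
    h d at a finite stage q; so g vanishes on the images in K_n of the cycles of
    K_q, and these images are zero in homology by the choice of g. *)
Lemma homology_dies (n i : nat) :
  (forall E : lmodType R, injective_module E -> forall c,
     co_d (cech xs (homod M E)) i.+1 c = 0 -> exists b, c = co_d (cech xs (homod M E)) i b) ->
  exists (m : nat) (le_nm : (n <= m)%N), forall h, homology_map (phi le_nm) i.+1 h = 0.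
Proof.
move=> exact_cech.
have [E E_inj [j j0]] := enough_injectives (homology (K n) i.+1).
pose Z := ch_cycles (K n) i.+1.
have val_injZ : injective (@submod_val _ _ _ : Z -> K n i.+1) by exact: val_inj.
have [g gP] := E_inj Z (K n i.+1) (@submod_val _ _ _) (j \o qpi _) val_injZ.
pose P := cech_presentation M E xs.
have [b] : exists b, P n i.+1 (hom_of g) = co_d (cech xs (homod M E)) i b.
  apply: exact_cech => //; rewrite cp_d -[RHS](raddf0 (P n i.+2)); congr (P n i.+2 _).
  apply: homod_ext => z; rewrite hpreE hom_ofE.
  have dz : ch_cycle (ch_d (K n) i.+1 z) by exact: ch_dd.
  pose zc : Z := cycle_of dz.
  rewrite (gP zc) /= (_ : qpi _ zc = 0) ?raddf0 //.
  by rewrite -(raddf0 (qpi _)); apply/qpi_eq; rewrite subr0; exists z.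
have [p [h ->]] := cp_surj P b; rewrite cp_d => gh.
pose m := maxn n p; pose le_nm := leq_maxl n p; pose le_pm := leq_maxr n p.
have : P m i.+1 (hpre (phi le_nm i.+1) (hom_of g) -
    hpre (phi le_pm i.+1) (hpre (ch_d (K p) i) h)) = 0.
  by rewrite linearB !cp_phi gh subrr.
move=> /cp_ker[m0 m0P].
pose q := maxn m m0; pose le_mq := leq_maxl m m0.
have le_nq := leq_trans le_nm le_mq.
exists q, le_nq; apply/homology_map_eq0P => z dz.
have dw : ch_cycle (phi le_nq i.+1 z).
  by rewrite /ch_cycle -cm_d [ch_d _ _ z]dz raddf0.
pose w : Z := cycle_of dw.
have : j (qpi _ w) = 0.
  rewrite -[LHS]gP /= -(koszul_map_comp le_nm le_mq).
  have := congr1 (fun u => happ u z) (m0P q le_mq (leq_maxr _ _)).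
  rewrite hpreE -[LHS]/(g (phi le_nm i.+1 (phi le_mq i.+1 z)) -
    happ h (ch_d (K p) i (phi le_pm i.+1 (phi le_mq i.+1 z)))).
  by rewrite -!cm_d [ch_d _ _ z]dz !raddf0 addr0.
move/j0; rewrite -(raddf0 (qpi _)) => /qpi_eq; rewrite subr0.
by case=> y; exists y.
Qed.

(** If a transition map kills homology in degree i + 1, so does every transition
    map that factors through it; finitely many degrees are thus treated by the
    largest of the stages found for each. *)
Lemma homology_dies_uniformly (n N : nat) :
  (forall i, exists (m : nat) (le_nm : (n <= m)%N),
     forall h, homology_map (phi le_nm) i.+1 h = 0) ->
  exists (m : nat) (le_nm : (n <= m)%N),
    forall i, (i < N)%N -> forall h, homology_map (phi le_nm) i.+1 h = 0.
Proof.
move=> dies; elim: N => [|N [m [le_nm IH]]]; first by exists n, (leqnn n).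
have [p [le_np pP]] := dies N.
exists (maxn m p), (leq_trans le_nm (leq_maxl m p)) => i; rewrite ltnS => le_iN.
have kill q (le_nq : (n <= q)%N) (le_q : (q <= maxn m p)%N) :
    (forall h, homology_map (phi le_nq) i.+1 h = 0) ->
    forall h, homology_map (phi (leq_trans le_nm (leq_maxl m p))) i.+1 h = 0.
  move=> /homology_map_eq0P qP; apply/homology_map_eq0P => z dz.
  rewrite -(koszul_map_comp le_nq le_q); apply: qP.
  by rewrite /ch_cycle -cm_d [ch_d _ _ z]dz raddf0.
case: (ltngtP i N) le_iN => // [lt_iN _|iN _].
  exact: kill (leq_maxl _ _) (IH i lt_iN).
by subst i; exact: kill (leq_maxr _ _) pP.
Qed.

End Equivalence.

Theorem theorem3p2 (R : comPzRingType) (M : lmodType R) (xs : seq R) :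
  weakly_proregular xs M <->
  (forall E : lmodType R, injective_module E ->
     forall i : nat, i <> 0%N -> forall h : cech_cohomology xs (homod M E) i, h = 0).
Proof.
split=> [wpr E E_inj [|i] // _|cech0 n].
  apply/cohomology_eq0P => c; exact: cech_exact_of_weakly_proregular.
have [|m [le_nm mP]] := @homology_dies_uniformly R M xs n (size xs).
  move=> i; apply: homology_dies => E E_inj.
  by apply/cohomology_eq0P; exact: (cech0 E E_inj i.+1).
exists m, le_nm => -[|i] // _.
(* Beyond the length of the sequence the Koszul complex itself is zero. *)
have [/mP //|le_i] := ltnP i (size xs).
apply/homology_map_eq0P => z _; exists 0.
rewrite raddf0 [z]koszul_vanish ?raddf0 //.
by rewrite size_map.
Qed.
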